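(* For all $\Delta,\Gamma,\tau$ and terms $e,e'$ with $\Delta;\Gamma\vdash e:\tau$ and $\Delta;\Gamma\vdash e':\tau$: $\Delta;\Gamma\vdash e\lesssim^{log}_{\Downarrow} e':\tau$ if and only if $\Delta;\Gamma\vdash e\lesssim^{ciu}_{\Downarrow} e':\tau$.
   Context: Language. Types: $\tau ::= \alpha \mid \mathbf{1} \mid \tau_1\times\tau_2 \mid \tau_1\to\tau_2 \mid \mu\alpha.(\tau_1+\dots+\tau_n) \mid \forall\alpha.\tau$. Values: $v ::= x \mid \langle\rangle \mid \langle v_1,v_2\rangle \mid \lambda x.e \mid \mathsf{in}_i\,v \mid \Lambda\alpha.e$. Terms: $e ::= v \mid ? \mid \mathsf{proj}_i\,v \mid v\,e \mid \mathsf{case}\,v\,\mathsf{of}\,(\mathsf{in}_1 x_1\Rightarrow e_1\mid\dots\mid \mathsf{in}_n x_n\Rightarrow e_n) \mid v[\tau]$. Evaluation contexts: $E ::= [\,] \mid v\,E$. One-step reduction $\mapsto$: $\mathsf{proj}_i\langle v_1,v_2\rangle\mapsto v_i$; $(\lambda x.e)\,v\mapsto e[v/x]$; $(\Lambda\alpha.e)[\tau]\mapsto e[\tau/\alpha]$; $\mathsf{case}\,(\mathsf{in}_j v)\,\mathsf{of}(\dots\mid\mathsf{in}_j x_j\Rightarrow e_j\mid\dots)\mapsto e_j[v/x_j]$ (an unfold-fold reduction); $?\mapsto \underline{n}$ for every $n\in\mathbb N$; and $v\,e\mapsto v\,e'$ whenever $e\mapsto e'$. Here $\mathsf{nat}=\mu\alpha.(\mathbf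 1+\alpha)$, $\underline 0=\mathsf{in}_1\langle\rangle$, $\underline{n+1}=\mathsf{in}_2\,\underline n$. Typing $\Delta;\Gamma\vdash e:\tau$ is standard for a call-by-value polymorphic lambda calculus with iso-recursive sums ($\mathsf{in}_j v:\mu\alpha.(\tau_1+\dots+\tau_n)$ when $v:\tau_j[\mu\alpha.(\dots)/\alpha]$; case branches bind $x_j:\tau_j[\mu\alpha.(\dots)/\alpha]$; $?:\mathsf{nat}$; $\Lambda\alpha.e:\forall\alpha.\tau$; $v[\tau']:\tau[\tau'/\alpha]$). $\mathsf{Type}$ = closed types; $\mathrm{Val}(\tau),\mathrm{Tm}(\tau)$ = closed values/terms of type $\tau$; $\mathrm{Stk}(\tau)$ = evaluation contexts $E$ with $E[e]$ closed well-typed for every $e\in\mathrm{Tm}(\tau)$; $\mathrm{Subst}(\Gamma)$ = substitutions mapping each $x{:}\sigma\in\Gamma$ into $\mathrm{Val}(\sigma)$. $e\Downarrow$ ($e$ must-converges) means there is no infinite reduction sequence from $e$. Write $e\leadsto^1 e'$ if $e\mapsto^* e'$ by a sequence in which exactly one step is an unfold-fold reduction. For ordinals $\beta$, $e\Downarrow_\beta$ iff for every $e'$ with $e\leadsto^1 e'$ there is $\nu<\beta$ with $e'\Downarrow_\nu$. Must-CIU preorder: $\Delta;\Gamma\vdash e\lesssim^{ciu}_{\Downarrow} e':\tau$ iff for all $\delta\in\mathsf{Type}^\Delta$, $\gamma\in\mathrm{Subst}(\Gamma\delta)$, $E\in\mathrm{Stk}(\tau\delta)$: $E[e\delta\gamma]\Downarrow$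 implies $E[e'\delta\gamma]\Downarrow$. Logical relation. Let $\omega_1$ be the least uncountable ordinal. An $\omega_1$-indexed uniform subset of $X$ is a family $(r_\beta)_{\beta<\omega_1}$ of subsets of $X$ with $r_0=X$, $r_{\beta+1}\subseteq r_\beta$, and $r_\lambda=\bigcap_{\beta<\lambda}r_\beta$ for limit $\lambda$. For closed $\sigma,\sigma'$, $\mathrm{VRel}_{\omega_1}(\sigma,\sigma')$ is the set of such subsets of $\mathrm{Val}(\sigma)\times\mathrm{Val}(\sigma')$. For such $r$: $r^{\top}_\beta=\{(E,E')\in\mathrm{Stk}(\sigma)\times\mathrm{Stk}(\sigma')\mid\forall \nu\le \beta\,\forall(v,v')\in r_\nu.\ E[v]\Downarrow_\nu\Rightarrow E'[v']\Downarrow\}$ and $r^{\top\top}_\beta=\{(e,e')\in\mathrm{Tm}(\sigma)\times\mathrm{Tm}(\sigma')\mid\forall \nu\le \beta\,\forall(E,E')\in r^\top_\nu.\ E[e]\Downarrow_\nu\Rightarrow E'[e']\Downarrow\}$. For $\tau$ with free type variables among $\alpha_1,\dots,\alpha_k$ and $r_i\in\mathrm{VRel}_{\omega_1}(\sigma_i,\sigma_i')$, define $[\![\tau]\!](\vec r)\in\mathrm{VRel}_{\omega_1}(\tau[\vec\sigma/\vec\alpha],\tau[\vec\sigma'/\vec\alpha])$ by induction on $\tau$: $[\![\alpha_i]\!](\vec r)=r_i$; $[\![\mathbf 1]\!](\vec r)_\beta=\{(\langle\rangle,\langle\rangle)\}$; $[\![\tau_1\times\tau_2]\!](\vec r)_\beta=\{(\langle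 v_1,v_2\rangle,\langle v_1',v_2'\rangle)\mid (v_i,v_i')\in[\![\tau_i]\!](\vec r)_\beta\}$; $[\![\tau_1\to\tau_2]\!](\vec r)_\beta=\{(\lambda x.e,\lambda x.e')\mid\forall \beta'\le \beta\,\forall(v,v')\in[\![\tau_1]\!](\vec r)_{\beta'}.\ (e[v/x],e'[v'/x])\in([\![\tau_2]\!](\vec r))^{\top\top}_{\beta'}\}$; $[\![\forall\alpha.\tau]\!](\vec r)_\beta=\{(\Lambda\alpha.e,\Lambda\alpha.e')\mid\forall\rho,\rho'\in\mathsf{Type}\,\forall s\in\mathrm{VRel}_{\omega_1}(\rho,\rho').\ (e[\rho/\alpha],e'[\rho'/\alpha])\in([\![\tau]\!](\vec r,s))^{\top\top}_\beta\}$; $[\![\mu\alpha.(\tau_1+\dots+\tau_m)]\!](\vec r)$ is the unique uniform relation $t$ such that $t_0$ contains all pairs of values of the two types, $t_{\beta+1}=\{(\mathsf{in}_jv,\mathsf{in}_jv')\mid 1\le j\le m,\ (v,v')\in[\![\tau_j]\!](\vec r,t)_\beta\}$, and $t_\lambda=\bigcap_{\beta<\lambda}t_\beta$ for limit $\lambda$. $(\gamma,\gamma')\in[\![\Gamma]\!](\vec r)_\beta$ iff $(\gamma(x),\gamma'(x))\in[\![\tau]\!](\vec r)_\beta$ for all $x{:}\tau\in\Gamma$. For $\Delta=\vec\alpha$: $\Delta;\Gamma\vdash e\lesssim^{log}_{\Downarrow}e':\tau$ iff both are well-typed and for all closed $\vec\sigma,\vec\sigma'$, all $\vec r\in\mathrm{VRel}_{\omega_1}(\vec\sigma,\vec\sigma')$,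 all $\beta<\omega_1$ and all $(\gamma,\gamma')\in[\![\Gamma]\!](\vec r)_\beta$, $(e[\vec\sigma/\vec\alpha]\gamma,e'[\vec\sigma'/\vec\alpha]\gamma')\in([\![\tau]\!](\vec r))^{\top\top}_\beta$.
   Formalization: The relations instantiating type variables (r, and s in the clause for ∀) are only required to be decreasing: r_0 = X and r_λ = ∩ r_β are dropped, since [[1→1]] violates them and, with them, y:∀α.α×α→α ⊢ y[1→1] is not log-related to itself. *)

(* Defs.v *)
From HB Require Import structures.
From mathcomp Require Import all_boot all_order.
From mathcomp Require Import boolp wochoice classical_sets functions cardinality.
From Stdlib Require Import Relation_Operators.

Set Implicit Arguments.
Unset Strict Implicit.
Unset Printing Implicit Defensive.

Import Order.TTheory.
Local Open Scope order_scope.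

(** * Syntax *)

(* Type and term variables are de Bruijn indices, in two separate name spaces.
   [Mu [:: A1; ...; An]] is the recursive sum mu a.(A1 + ... + An): the variable
   a is bound (index 0) in every [Ai]. *)
Inductive ty : Type :=
| TVar (i : nat)
| One
| Prod (A B : ty)
| Arr (A B : ty)
| Mu (As : seq ty)
| All (A : ty).

(* Sum injections and case branches are numbered from 0, so that the injection
   in_j of the paper is [In j.-1]; the branches of [Case] bind one term variable
   each. *)
Inductive value : Type :=
| Var (x : nat)
| Unit
| Pair (v w : value)
| Lam (e : exp)
| In (j : nat) (v : value)
| TLam (e : exp)
with exp : Type :=
| Ret (v : value)
| Choose
| Fst (v : value)
| Snd (v : value)
| App (v : value) (e : exp)
| Case (v : value) (es : seq exp)
| TApp (v : value) (A : ty).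

Inductive ectx : Type :=
| Hole
| AppR (v : value) (E : ectx).

Fixpoint fill (E : ectx) (e : exp) : exp :=
  if E is AppR v E' then App v (fill E' e) else e.

(** * Renaming and parallel substitution *)

Definition scons {X : Type} (x : X) (f : nat -> X) (i : nat) : X :=
  if i is j.+1 then f j else x.

Definition upren (xi : nat -> nat) : nat -> nat := scons 0%N (succn \o xi).

Fixpoint tren (xi : nat -> nat) (A : ty) : ty :=
  match A with
  | TVar i => TVar (xi i)
  | One => One
  | Prod A B => Prod (tren xi A) (tren xi B)
  | Arr A B => Arr (tren xi A) (tren xi B)
  | Mu As => Mu (map (tren (upren xi)) As)
  | All A => All (tren (upren xi) A)
  end.

Definition tup (d : nat -> ty) : nat -> ty := scons (TVar 0) (tren succn \o d).

Fixpoint tsubst (d : nat -> ty) (A : ty) : ty :=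
  match A with
  | TVar i => d i
  | One => One
  | Prod A B => Prod (tsubst d A) (tsubst d B)
  | Arr A B => Arr (tsubst d A) (tsubst d B)
  | Mu As => Mu (map (tsubst (tup d)) As)
  | All A => All (tsubst (tup d) A)
  end.

Definition tsubst1 (B A : ty) : ty := tsubst (scons B TVar) A.

(* [xi] renames type variables and [ze] renames term variables. *)
Fixpoint vren (xi ze : nat -> nat) (v : value) : value :=
  match v with
  | Var x => Var (ze x)
  | Unit => Unit
  | Pair v w => Pair (vren xi ze v) (vren xi ze w)
  | Lam e => Lam (eren xi (upren ze) e)
  | In j v => In j (vren xi ze v)
  | TLam e => TLam (eren (upren xi) ze e)
  end
with eren (xi ze : nat -> nat) (e : exp) : exp :=
  match e with
  | Ret v => Ret (vren xi ze v)
  | Choose => Choose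
  | Fst v => Fst (vren xi ze v)
  | Snd v => Snd (vren xi ze v)
  | App v e => App (vren xi ze v) (eren xi ze e)
  | Case v es => Case (vren xi ze v) (map (eren xi (upren ze)) es)
  | TApp v A => TApp (vren xi ze v) (tren xi A)
  end.

Definition vup (g : nat -> value) : nat -> value :=
  scons (Var 0) (vren id succn \o g).

(* [d] is substituted for the type variables and [g] for the term variables,
   simultaneously. *)
Fixpoint vsubst (d : nat -> ty) (g : nat -> value) (v : value) : value :=
  match v with
  | Var x => g x
  | Unit => Unit
  | Pair v w => Pair (vsubst d g v) (vsubst d g w)
  | Lam e => Lam (esubst d (vup g) e)
  | In j v => In j (vsubst d g v)
  | TLam e => TLam (esubst (tup d) (vren succn id \o g) e)
  end
with esubst (d : nat -> ty) (g : nat -> value) (e : exp) : exp :=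
  match e with
  | Ret v => Ret (vsubst d g v)
  | Choose => Choose
  | Fst v => Fst (vsubst d g v)
  | Snd v => Snd (vsubst d g v)
  | App v e => App (vsubst d g v) (esubst d g e)
  | Case v es => Case (vsubst d g v) (map (esubst d (vup g)) es)
  | TApp v A => TApp (vsubst d g v) (tsubst d A)
  end.

Definition esubst1 (v : value) (e : exp) : exp := esubst TVar (scons v Var) e.
Definition etsubst1 (A : ty) (e : exp) : exp := esubst (scons A TVar) Var e.

(** * Reduction *)

Definition natT : ty := Mu [:: One; TVar 0].

Fixpoint num (n : nat) : value :=
  if n is m.+1 then In 1 (num m) else In 0 Unit.

(* The label is [true] for the unfold-fold reductions. *)
Inductive step : bool -> exp -> exp -> Prop :=
| step_fst v w : step false (Fst (Pair v w)) (Ret v)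
| step_snd v w : step false (Snd (Pair v w)) (Ret w)
| step_beta e v : step false (App (Lam e) (Ret v)) (esubst1 v e)
| step_tbeta e A : step false (TApp (TLam e) A) (etsubst1 A e)
| step_choose n : step false Choose (Ret (num n))
| step_case j v es e :
    onth es j = Some e -> step true (Case (In j v) es) (esubst1 v e)
| step_app b v e e' : step b e e' -> step b (App v e) (App v e').

Definition red (e e' : exp) : Prop := exists b, step b e e'.

Definition red1 (e e' : exp) : Prop :=
  exists e1 e2, [/\ clos_refl_trans exp (step false) e e1,
    step true e1 e2 & clos_refl_trans exp (step false) e2 e'].

Definition must (e : exp) : Prop :=
  ~ exists f : nat -> exp, f 0%N = e /\ forall i, red (f i) (f i.+1).

(** * Typing *)

Fixpoint wf_ty (n : nat) (A : ty) : bool :=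
  match A with
  | TVar i => (i < n)%N
  | One => true
  | Prod A B => wf_ty n A && wf_ty n B
  | Arr A B => wf_ty n A && wf_ty n B
  | Mu As => all (wf_ty n.+1) As
  | All A => wf_ty n.+1 A
  end.

Definition wf_ctx (n : nat) (G : seq ty) : bool := all (wf_ty n) G.

(* In [val_ty n G v A] and [exp_ty n G e A], the type context consists of the
   variables with index below [n], and [onth G x] is the type of the term
   variable [x]. Both judgements presuppose [wf_ctx n G]. *)
Inductive val_ty : nat -> seq ty -> value -> ty -> Prop :=
| ty_var n G x A : onth G x = Some A -> val_ty n G (Var x) A
| ty_unit n G : val_ty n G Unit One
| ty_pair n G v w A B :
    val_ty n G v A -> val_ty n G w B -> val_ty n G (Pair v w) (Prod A B)
| ty_lam n G e A B :
    wf_ty n A -> exp_ty n (A :: G) e B -> val_ty n G (Lam e) (Arr A B)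
| ty_in n G j v As A :
    wf_ty n (Mu As) -> onth As j = Some A ->
    val_ty n G v (tsubst1 (Mu As) A) -> val_ty n G (In j v) (Mu As)
| ty_tlam n G e A :
    exp_ty n.+1 (map (tren succn) G) e A -> val_ty n G (TLam e) (All A)
with exp_ty : nat -> seq ty -> exp -> ty -> Prop :=
| ty_ret n G v A : val_ty n G v A -> exp_ty n G (Ret v) A
| ty_choose n G : exp_ty n G Choose natT
| ty_fst n G v A B : val_ty n G v (Prod A B) -> exp_ty n G (Fst v) A
| ty_snd n G v A B : val_ty n G v (Prod A B) -> exp_ty n G (Snd v) B
| ty_app n G v e A B :
    val_ty n G v (Arr A B) -> exp_ty n G e A -> exp_ty n G (App v e) B
| ty_case n G v es As B :
    val_ty n G v (Mu As) -> size es = size As -> wf_ty n B ->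
    (forall j e A, onth es j = Some e -> onth As j = Some A ->
       exp_ty n (tsubst1 (Mu As) A :: G) e B) ->
    exp_ty n G (Case v es) B
| ty_tapp n G v A B :
    val_ty n G v (All A) -> wf_ty n B -> exp_ty n G (TApp v B) (tsubst1 B A).

Definition closed_ty (A : ty) : bool := wf_ty 0 A.
Definition cval (A : ty) (v : value) : Prop := val_ty 0 [::] v A.
Definition cexp (A : ty) (e : exp) : Prop := exp_ty 0 [::] e A.
Definition stk (A : ty) (E : ectx) : Prop :=
  forall e, cexp A e -> exists B, cexp B (fill E e).

(* The values of a type substitution beyond the type context, and of a value
   substitution beyond the term context, are irrelevant. *)
Definition ty_substitution (n : nat) (d : nat -> ty) : Prop :=
  forall i, (i < n)%N -> closed_ty (d i).
Definition val_substitution (G : seq ty) (g : nat -> value) : Prop :=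
  forall x A, onth G x = Some A -> cval A (g x).

Definition ciu (n : nat) (G : seq ty) (e e' : exp) (A : ty) : Prop :=
  forall d g E, ty_substitution n d -> val_substitution (map (tsubst d) G) g ->
    stk (tsubst d A) E ->
    must (fill E (esubst d g e)) -> must (fill E (esubst d g e')).

(** * The ordinal omega_1 *)

(* The well-orders of type omega_1: they are uncountable, and all their proper
   initial segments are countable. *)
Definition is_omega1 (disp : Order.disp_t) (W : orderType disp) : Prop :=
  [/\ well_order (<=%O : rel W),
      forall b : W, countable [set c : W | c < b] &
      ~ countable [set: W]].

Section WellOrderType.
Context (T : choiceType) (R : rel T) (woR : well_order R).

Definition wo_type : Type := T.
HB.instance Definition _ := Choice.on wo_type.

Let le_wo : rel wo_type := R.

Fact le_wo_chain : wo_chain le_wo predT. Proof. by move=> B _; exact: woR. Qed.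

Fact le_wo_refl : reflexive le_wo.
Proof. by move=> x; exact: (wo_chain_reflexive le_wo_chain). Qed.

Fact le_wo_anti : antisymmetric le_wo.
Proof. by move=> x y Rxy; exact: (wo_chain_antisymmetric le_wo_chain). Qed.

Fact le_wo_trans : transitive le_wo.
Proof.
move=> y x z Rxy Ryz.
have [|m [[mA mlb] _]] := woR (A := [pred u | u \in [:: x; y; z]]).
  by exists x; rewrite !inE eqxx.
have [mx my mz] : [/\ R m x, R m y & R m z].
  by split; apply: mlb; rewrite !inE eqxx ?orbT.
move: mA; rewrite !inE => /or3P[] /eqP mE.
- by rewrite -mE.
- by have -> // : x = y by apply: le_wo_anti; rewrite Rxy -mE.
- by have <- // : y = z by apply: le_wo_anti; rewrite Ryz -mE.
Qed.

Fact le_wo_total : total le_wo.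
Proof. by move=> x y; exact: (wo_chainW le_wo_chain). Qed.

HB.instance Definition _ := Order.Le_isPOrder.Build (Order.Disp tt tt) wo_type
  le_wo_refl le_wo_anti le_wo_trans.
HB.instance Definition _ :=
  Order.POrder_isTotal.Build (Order.Disp tt tt) wo_type le_wo_total.

Definition wo_orderType : orderType (Order.Disp tt tt) := wo_type.

End WellOrderType.

Lemma countable_inj T U (f : T -> U) (A : set T) (B : set U) :
  (forall x, A x -> B (f x)) -> injective f -> countable B -> countable A.
Proof.
move=> fAB f_inj /countable_injP[h h_inj]; apply/countable_injP.
exists (h \o f) => x y /set_mem xA /set_mem yA /= /h_inj-/(_ _ _)/f_inj.
by apply; exact/mem_set/fAB.
Qed.

Lemma omega1_exists : exists W : orderType (Order.Disp tt tt), is_omega1 W.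
Proof.
suff [T [R [woR seg unc]]] : exists (T : choiceType) (R : rel T),
    [/\ well_order R, forall x, countable [set y | R y x && (y != x)] &
        ~ countable [set: T]].
  exists (wo_orderType woR); split=> // b.
  by apply: (countable_inj (f := id) _ _ (seg b)) => //= c; rewrite lt_neqAle andbC.
have [R woR] := well_ordering_principle (set nat).
have cR : wo_chain R predT by move=> B _; exact: woR.
have unc : ~ countable [set: set nat].
  move=> /countable_injP[f f_inj].
  pose D : set nat := fun k => exists2 X, f X = k & ~ X k.
  have DfD : D (f D) -> ~ D (f D).
    by move=> [X fX nX]; rewrite -{1}(f_inj X D (mem_set I) (mem_set I) fX).
  have nD : ~ D (f D) by move=> d; exact: (DfD d d).
  by apply: (nD); exists D.
pose seg x : set (set nat) := fun y => R y x && (y != x).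
have [all_c|] := pselect (forall x, countable (seg x)).
  by exists (set nat), R.
move=> /existsNP[x0 x0_unc].
have [|m [[mA mlb] _]] := woR [pred x | `[< ~ countable (seg x) >]].
  by exists x0; apply/asboolP.
have m_unc : ~ countable (seg m) by apply/asboolP; exact: mA.
exists {x : set nat | R x m && (x != m)}, (fun x y => R (val x) (val y)); split.
- move=> A [x xA].
  have [|y [[yA ylb] _]] := woR [pred u | `[< exists2 a, a \in A & val a = u >]].
    by exists (val x); apply/asboolP; exists x.
  have /asboolP[a aA ay] := yA.
  have a_lb : lower_bound (fun x y => R (val x) (val y)) A a.
    by move=> b bA; rewrite ay ylb //; apply/asboolP; exists b.
  exists a; split=> // b [bA blb]; apply: val_inj.
  by apply: (wo_chain_antisymmetric cR) => //; rewrite a_lb // blb.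
- move=> x; have x_c : countable (seg (val x)).
    apply: contrapT => nx; have /andP[xm] := valP x; case/negP; apply/eqP.
    apply: (wo_chain_antisymmetric cR) => //; rewrite xm mlb //.
    exact/asboolP.
  exact: (countable_inj _ val_inj x_c).
- move=> /countable_injP[h h_inj]; apply: m_unc; apply/countable_injP.
  exists (fun x => if insub x is Some y then h y else 0%N) => x y.
  rewrite !in_setE => xm ym; rewrite !insubT => /h_inj.
  by rewrite !in_setT => /(_ isT isT)[].
Qed.

Section Ordinals.
Context {disp : Order.disp_t} {W : orderType disp}.
Implicit Types b c l : W.

Definition is_zero b : Prop := forall c, b <= c.
Definition is_succ b c : Prop := b < c /\ forall x, b < x -> c <= x.
Definition is_limit l : Prop := ~ is_zero l /\ ~ exists b, is_succ b l.

(* The relation is the unique solution of its defining equation. *)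
Inductive conv : W -> exp -> Prop :=
| conv_intro b e :
    (forall e', red1 e e' -> exists2 c, c < b & conv c e') -> conv b e.

End Ordinals.

(** * The logical relation *)

Section LogicalRelation.
Context {disp : Order.disp_t} {W : orderType disp}.

Definition family : Type := W -> value -> value -> Prop.

Definition on_values (A A' : ty) (r : family) : Prop :=
  forall b v v', r b v v' -> cval A v /\ cval A' v'.

Definition uniform (A A' : ty) (r : family) : Prop :=
  [/\ on_values A A' r,
      forall b v v', is_zero b -> cval A v -> cval A' v' -> r b v v',
      forall b c v v', is_succ b c -> r c v v' -> r b v v' &
      forall l v v', is_limit l ->
        (r l v v' <-> forall b, b < l -> r b v v')].

(* The relations over which type variables range. Only the decreasing part of
   [uniform] is required: at a limit [l], [r l] is included in every earlier
   [r b]. The two other conditions are not satisfied by the relations [interp A]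
   that have to instantiate type variables: as [conv b e] can hold for the least
   [b], the interpretation of [Arr One One] is not total there (see
   [interp_arr_not_uniform]), and as [conv l e] can hold at a limit [l] and at no
   smaller index, it is not an intersection at limits either. *)
Definition vrel (A A' : ty) (r : family) : Prop :=
  on_values A A' r /\ forall b c v v', b <= c -> r c v v' -> r b v v'.

Definition top_rel (A A' : ty) (r : family) (b : W) (E E' : ectx) : Prop :=
  [/\ stk A E, stk A' E' &
      forall c v v', c <= b -> r c v v' ->
        conv c (fill E (Ret v)) -> must (fill E' (Ret v'))].

Definition bitop_rel (A A' : ty) (r : family) (b : W) (e e' : exp) : Prop :=
  [/\ cexp A e, cexp A' e' &
      forall c E E', c <= b -> top_rel A A' r c E E' ->
        conv c (fill E e) -> must (fill E' e')].

(* A relation between the closed types [src] and [tgt]. *)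
Record rel_entry : Type := Entry { src : ty; tgt : ty; rel_of : family }.

Definition rel_env : Type := nat -> rel_entry.
Definition srcs (rho : rel_env) : nat -> ty := src \o rho.
Definition tgts (rho : rel_env) : nat -> ty := tgt \o rho.

Definition wf_env (n : nat) (rho : rel_env) : Prop :=
  forall i, (i < n)%N ->
    [/\ closed_ty (src (rho i)), closed_ty (tgt (rho i)) &
        vrel (src (rho i)) (tgt (rho i)) (rel_of (rho i))].

(* [Fs] lists the interpretations of the summands as functions of the relation
   [t] interpreting the recursive type itself. *)
Definition mu_solution (A A' : ty) (Fs : seq (family -> family)) (t : family) :=
  uniform A A' t /\
  forall b c, is_succ b c -> forall v v', t c v v' <->
    exists j F w w', [/\ onth Fs j = Some F, v = In j w, v' = In j w' &
      F t b w w'].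

Fixpoint interp (A : ty) (rho : rel_env) {struct A} : family :=
  match A with
  | TVar i => rel_of (rho i)
  | One => fun _ v v' => v = Unit /\ v' = Unit
  | Prod A1 A2 => fun b v v' => exists v1 v2 v1' v2',
      [/\ v = Pair v1 v2, v' = Pair v1' v2', interp A1 rho b v1 v1' &
          interp A2 rho b v2 v2']
  | Arr A1 A2 => fun b v v' => exists e e',
      [/\ v = Lam e, v' = Lam e',
          cval (tsubst (srcs rho) A) v, cval (tsubst (tgts rho) A) v' &
          forall c w w', c <= b -> interp A1 rho c w w' ->
            bitop_rel (tsubst (srcs rho) A2) (tsubst (tgts rho) A2)
              (interp A2 rho) c (esubst1 w e) (esubst1 w' e')]
  | Mu As => fun b v v' => exists2 t,
      mu_solution (tsubst (srcs rho) A) (tsubst (tgts rho) A)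
        (map (fun B t => interp B
                (scons (Entry (tsubst (srcs rho) A) (tsubst (tgts rho) A) t)
                   rho)) As) t &
      t b v v'
  | All B => fun b v v' => exists e e',
      [/\ v = TLam e, v' = TLam e',
          cval (tsubst (srcs rho) A) v, cval (tsubst (tgts rho) A) v' &
          forall C C' s, closed_ty C -> closed_ty C' -> vrel C C' s ->
            let rho' := scons (Entry C C' s) rho in
            bitop_rel (tsubst (srcs rho') B) (tsubst (tgts rho') B)
              (interp B rho') b (etsubst1 C e) (etsubst1 C' e')]
  end.

Definition interp_ctx (G : seq ty) (rho : rel_env) (b : W)
    (g g' : nat -> value) : Prop :=
  forall x A, onth G x = Some A -> interp A rho b (g x) (g' x).

Definition log (n : nat) (G : seq ty) (e e' : exp) (A : ty) : Prop :=
  [/\ exp_ty n G e A, exp_ty n G e' A &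
      forall rho b g g', wf_env n rho -> interp_ctx G rho b g g' ->
        bitop_rel (tsubst (srcs rho) A) (tsubst (tgts rho) A) (interp A rho) b
          (esubst (srcs rho) g e) (esubst (tgts rho) g' e')].

Definition delta : value :=
  Lam (Case (Var 0) [:: App (Var 0) (Ret (Var 1))]).
Definition omega : exp := App delta (Ret (In 0 delta)).

Lemma omega_ty n G : exp_ty n G omega One.
Proof.
have delta_ty : val_ty n G delta (Arr (Mu [:: Arr (TVar 0) One]) One).
  apply: ty_lam => //; apply: (ty_case (As := [:: Arr (TVar 0) One])) => //.
    exact: ty_var.
  case=> [|[|j]] e A //= [<-] [<-]; rewrite /tsubst1 /=.
  by apply: ty_app; last apply: ty_ret; apply: ty_var; reflexivity.
by apply: ty_app; [exact: delta_ty|apply: ty_ret; apply: ty_in].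
Qed.

Lemma omega_diverges : ~ must omega.
Proof.
apply; exists (fun i => if odd i then
  Case (In 0 delta) [:: App (Var 0) (Ret (In 0 delta))] else omega).
split=> // i; rewrite oddS; case: (odd i) => /=.
  exists true.
  exact: (@step_case 0 delta [:: App (Var 0) (Ret (In 0 delta))] _ erefl).
by exists false; exact: step_beta.
Qed.

Lemma interp_arr_not_uniform (b : W) (rho : rel_env) : is_zero b ->
  ~ uniform (Arr One One) (Arr One One) (interp (Arr One One) rho).
Proof.
move=> b0 [_ r0 _ _].
have [||e [e' [[<-] [<-] _ _ h]]] := r0 b (Lam (Ret Unit)) (Lam omega) b0.
- by apply: ty_lam => //; apply: ty_ret; exact: ty_unit.
- by apply: ty_lam => //; exact: omega_ty.
have [_ _ {}h] := h b Unit Unit (le_refl b) (conj erefl erefl).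
apply: omega_diverges; apply: (h b Hole Hole (le_refl b)).
  split=> [e1 t|e1 t|c v v' _ [_ ->] _]; [by exists One|by exists One|].
  by move=> [f [f0 /(_ 0%N)]]; rewrite f0 => -[l s]; inversion s.
apply: conv_intro => e2 [e3 [e4 [s3 s4 _]]].
suff e3E : e3 = Ret Unit by rewrite e3E in s4; inversion s4.
have {s3}: clos_refl_trans exp (step false) (Ret Unit) e3 by exact: s3.
move: (erefl (Ret Unit)); move: {1 3}(Ret Unit) => x xE s3.
elim: s3 xE => // [x1 y1 s xE|x1 y1 z1 _ IH1 _ IH2 /IH1 /IH2 //].
by rewrite xE in s; inversion s.
Qed.

End LogicalRelation.

(* Main.v *)
(* The forward direction instantiates each type variable by the relation of the
   closed type substituted for it. By the fundamental property, closed values and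
   evaluation contexts are then related to themselves, and [must] of a term gives
   [conv b] for some countable [b] because a term has countably many reducts and
   countable sets are bounded in omega_1. Conversely, [e] is logically related to
   itself by the fundamental property, and the logical relation is closed under
   the CIU preorder on the right, where only [must] is required.

   Typing is Curry-style, so that [stk A E] only provides, for every [e] of type
   [A], some typing of [fill E e], in which [e] may have another type. A term whose
   only type is [A] turns this into a typing of the frames of [E]. *)
Require Import Defs.
From mathcomp Require Import all_boot all_order.
From mathcomp Require Import boolp wochoice classical_sets cardinality.
From Stdlib Require Import Relation_Operators Wellfounded.Transitive_Closure.

Set Implicit Arguments.
Unset Strict Implicit.
Unset Printing Implicit Defensive.

Import Order.TTheory.
Local Open Scope order_scope.

(** * Substitution calculus *)

(** Computed by recursion on the list, so that the induction hypotheses for the components of [Mu]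
    and [Case] are built and destructed by plain reduction. *)
Definition all_prop T (P : T -> Prop) : seq T -> Prop :=
  fix F s := if s is x :: s' then P x /\ F s' else True.

Lemma all_prop_onth T (P : T -> Prop) s :
  all_prop P s -> forall j x, onth s j = Some x -> P x.
Proof.
elim: s => [|x s IH] /= => [_ [] //|[Px /IH h] [|j] y /=]; last exact: h.
by case=> <-.
Qed.

Lemma all_prop_eq_map T U (f g : T -> U) s :
  all_prop (fun x => f x = g x) s -> map f s = map g s.
Proof. by elim: s => //= x s IH [-> /IH ->]. Qed.

Lemma all_prop_impl T (P Q : T -> Prop) s :
  (forall x, P x -> Q x) -> all_prop P s -> all_prop Q s.
Proof. by move=> PQ; elim: s => //= x s IH [/PQ ? /IH]. Qed.

(** The recursion descends into the list of summands, which gives the case [Mu] a hypothesis for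
    each of them. *)
Lemma ty_nested_ind (P : ty -> Prop) :
  (forall i, P (TVar i)) -> P One ->
  (forall A B, P A -> P B -> P (Prod A B)) ->
  (forall A B, P A -> P B -> P (Arr A B)) ->
  (forall As, all_prop P As -> P (Mu As)) ->
  (forall A, P A -> P (All A)) -> forall A, P A.
Proof.
move=> hV h1 hP hA hM hL; fix IH 1 => -[i||A B|A B|As|A].
- exact: hV.
- exact: h1.
- by apply: hP; apply: IH.
- by apply: hA; apply: IH.
- apply: hM; elim: As => [|A As IHs]; first exact: I.
  by split; [apply: IH|apply: IHs].
- by apply: hL; apply: IH.
Qed.

Section TermInduction.
Variables (P : value -> Prop) (Q : exp -> Prop).
Hypotheses (hVar : forall x, P (Var x)) (hUnit : P Unit)
  (hPair : forall v w, P v -> P w -> P (Pair v w))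
  (hLam : forall e, Q e -> P (Lam e)) (hIn : forall j v, P v -> P (In j v))
  (hTLam : forall e, Q e -> P (TLam e)).
Hypotheses (hRet : forall v, P v -> Q (Ret v)) (hChoose : Q Choose)
  (hFst : forall v, P v -> Q (Fst v)) (hSnd : forall v, P v -> Q (Snd v))
  (hApp : forall v e, P v -> Q e -> Q (App v e))
  (hCase : forall v es, P v -> all_prop Q es -> Q (Case v es))
  (hTApp : forall v A, P v -> Q (TApp v A)).

Fixpoint value_nested_ind v : P v :=
  match v with
  | Var x => hVar x
  | Unit => hUnit
  | Pair v w => hPair (value_nested_ind v) (value_nested_ind w)
  | Lam e => hLam (exp_nested_ind e)
  | In j v => hIn j (value_nested_ind v)
  | TLam e => hTLam (exp_nested_ind e)
  end
with exp_nested_ind e : Q e :=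
  match e with
  | Ret v => hRet (value_nested_ind v)
  | Choose => hChoose
  | Fst v => hFst (value_nested_ind v)
  | Snd v => hSnd (value_nested_ind v)
  | App v e => hApp (value_nested_ind v) (exp_nested_ind e)
  | Case v es => hCase (value_nested_ind v)
      ((fix F s : all_prop Q s :=
          if s is e :: s' return all_prop Q s then conj (exp_nested_ind e) (F s')
          else I) es)
  | TApp v A => hTApp A (value_nested_ind v)
  end.

Lemma term_ind : (forall v, P v) /\ (forall e, Q e).
Proof. by split; [exact: value_nested_ind|exact: exp_nested_ind]. Qed.

End TermInduction.

Lemma scons_comp X Y (f : X -> Y) x g : f \o scons x g = scons (f x) (f \o g).
Proof. by apply: funext => -[]. Qed.

Lemma scons_upren X (x : X) f xi : scons x f \o upren xi = scons x (f \o xi).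
Proof. by apply: funext => -[]. Qed.

Lemma tup_TVar : tup TVar = TVar.
Proof. by apply: funext => -[]. Qed.

Lemma tsubst_id A : tsubst TVar A = A.
Proof.
elim/ty_nested_ind: A => //= [A B -> ->|A B -> ->|As IH|A IH] //.
  by congr Mu; rewrite tup_TVar -[RHS]map_id; exact: all_prop_eq_map.
by rewrite tup_TVar IH.
Qed.

(** First of the composition laws: substitution after renaming, then renaming after substitution,
    then two substitutions. The earlier laws carry the last one under a binder. *)
Lemma tsubst_tren A d xi : tsubst d (tren xi A) = tsubst (d \o xi) A.
Proof.
elim/ty_nested_ind: A d xi => //= [A B IHA IHB|A B IHA IHB|As IH|A IH] d xi.
- by rewrite IHA IHB.
- by rewrite IHA IHB.
- rewrite -map_comp; congr Mu; apply: all_prop_eq_map.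
  by apply: all_prop_impl IH => A IH; rewrite /= IH /tup scons_upren.
- by rewrite IH /tup scons_upren.
Qed.

(** Seeing a renaming as a substitution reduces the composition of two renamings to
    [tsubst_tren]. *)
Lemma tren_tsubst_var xi A : tren xi A = tsubst (TVar \o xi) A.
Proof.
elim/ty_nested_ind: A xi => //= [A B IHA IHB|A B IHA IHB|As IH|A IH] xi.
- by rewrite IHA IHB.
- by rewrite IHA IHB.
- congr Mu; apply: all_prop_eq_map; apply: all_prop_impl IH => A ->.
  by congr tsubst; apply: funext => -[].
- by rewrite IH; congr (All (tsubst _ _)); apply: funext => -[].
Qed.

Lemma tren_tren xi xi' A : tren xi (tren xi' A) = tren (xi \o xi') A.
Proof. by rewrite (tren_tsubst_var xi) tsubst_tren tren_tsubst_var. Qed.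

Lemma tren_id A : tren id A = A.
Proof. by rewrite tren_tsubst_var tsubst_id. Qed.

Lemma tren_tup xi d : tren (upren xi) \o tup d = tup (tren xi \o d).
Proof. by apply: funext => -[|i] //=; rewrite !tren_tren. Qed.

Lemma tren_tsubst A d xi : tren xi (tsubst d A) = tsubst (tren xi \o d) A.
Proof.
elim/ty_nested_ind: A d xi => //= [A B IHA IHB|A B IHA IHB|As IH|A IH] d xi.
- by rewrite IHA IHB.
- by rewrite IHA IHB.
- rewrite -map_comp; congr Mu; apply: all_prop_eq_map.
  by apply: all_prop_impl IH => A IH; rewrite /= IH tren_tup.
- by rewrite IH tren_tup.
Qed.

Lemma tsubst_tup d d' : tsubst (tup d) \o tup d' = tup (tsubst d \o d').
Proof. by apply: funext => -[|i] //=; rewrite tsubst_tren tren_tsubst. Qed.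

Lemma tsubst_tsubst A d d' : tsubst d (tsubst d' A) = tsubst (tsubst d \o d') A.
Proof.
elim/ty_nested_ind: A d d' => //= [A B IHA IHB|A B IHA IHB|As IH|A IH] d d'.
- by rewrite IHA IHB.
- by rewrite IHA IHB.
- rewrite -map_comp; congr Mu; apply: all_prop_eq_map.
  by apply: all_prop_impl IH => A IH; rewrite /= IH tsubst_tup.
- by rewrite IH tsubst_tup.
Qed.

(** This is the shape in which the unfolded summands of a substituted [Mu] occur: the body is closed
    by [d] first and its binder is opened afterwards. *)
Lemma tsubst1_tup B d A : tsubst1 B (tsubst (tup d) A) = tsubst (scons B d) A.
Proof.
rewrite /tsubst1 tsubst_tsubst; congr tsubst; apply: funext => -[|i] //=.
by rewrite tsubst_tren tsubst_id.
Qed.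

Lemma tsubst_tsubst1 d A B :
  tsubst d (tsubst1 B A) = tsubst1 (tsubst d B) (tsubst (tup d) A).
Proof.
by rewrite tsubst1_tup /tsubst1 tsubst_tsubst scons_comp.
Qed.

Lemma tren_tsubst1 xi A B :
  tren xi (tsubst1 B A) = tsubst1 (tren xi B) (tren (upren xi) A).
Proof. by rewrite /tsubst1 tsubst_tren tren_tsubst scons_comp scons_upren. Qed.

(** * Composition laws for renaming and substitution in terms *)

Lemma ren_ren :
  (forall v xi ze xi' ze',
     vren xi ze (vren xi' ze' v) = vren (xi \o xi') (ze \o ze') v) /\
  (forall e xi ze xi' ze',
     eren xi ze (eren xi' ze' e) = eren (xi \o xi') (ze \o ze') e).
Proof.
have up xi xi' : upren xi \o upren xi' = upren (xi \o xi').
  by apply: funext => -[].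
apply: term_ind => //=.
- by move=> v w IHv IHw *; rewrite IHv IHw.
- by move=> e IH *; rewrite IH up.
- by move=> j v IH *; rewrite IH.
- by move=> e IH *; rewrite IH up.
- by move=> v IH *; rewrite IH.
- by move=> v IH *; rewrite IH.
- by move=> v IH *; rewrite IH.
- by move=> v e IHv IHe *; rewrite IHv IHe.
- move=> v es IHv IHes xi ze xi' ze'; rewrite IHv -map_comp; congr Case.
  by apply: all_prop_eq_map; apply: all_prop_impl IHes => e IH /=; rewrite IH up.
- by move=> v A IH *; rewrite IH tren_tren.
Qed.

Lemma vup_upren g ze : vup g \o upren ze = vup (g \o ze).
Proof. exact: scons_upren. Qed.

Lemma subst_ren :
  (forall v d g xi ze, vsubst d g (vren xi ze v) = vsubst (d \o xi) (g \o ze) v) /\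
  (forall e d g xi ze, esubst d g (eren xi ze e) = esubst (d \o xi) (g \o ze) e).
Proof.
apply: term_ind => //=.
- by move=> v w IHv IHw *; rewrite IHv IHw.
- by move=> e IH *; rewrite IH vup_upren.
- by move=> j v IH *; rewrite IH.
- by move=> e IH *; rewrite IH /tup scons_upren.
- by move=> v IH *; rewrite IH.
- by move=> v IH *; rewrite IH.
- by move=> v IH *; rewrite IH.
- by move=> v e IHv IHe *; rewrite IHv IHe.
- move=> v es IHv IHes *; rewrite IHv -map_comp; congr Case.
  apply: all_prop_eq_map; apply: all_prop_impl IHes => e IH /=.
  by rewrite IH vup_upren.
- by move=> v A IH *; rewrite IH tsubst_tren.
Qed.

Lemma vren_vup xi ze g : vren xi (upren ze) \o vup g = vup (vren xi ze \o g).
Proof. by apply: funext => -[|x] //=; rewrite !ren_ren.1. Qed.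

Lemma ren_subst :
  (forall v xi ze d g,
     vren xi ze (vsubst d g v) = vsubst (tren xi \o d) (vren xi ze \o g) v) /\
  (forall e xi ze d g,
     eren xi ze (esubst d g e) = esubst (tren xi \o d) (vren xi ze \o g) e).
Proof.
apply: term_ind => //=.
- by move=> v w IHv IHw *; rewrite IHv IHw.
- by move=> e IH *; rewrite IH vren_vup.
- by move=> j v IH *; rewrite IH.
- move=> e IH xi ze d g; rewrite IH tren_tup; congr (TLam (esubst _ _ _)).
  by apply: funext => x /=; rewrite !ren_ren.1.
- by move=> v IH *; rewrite IH.
- by move=> v IH *; rewrite IH.
- by move=> v IH *; rewrite IH.
- by move=> v e IHv IHe *; rewrite IHv IHe.
- move=> v es IHv IHes *; rewrite IHv -map_comp; congr Case.
  apply: all_prop_eq_map; apply: all_prop_impl IHes => e IH /=.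
  by rewrite IH vren_vup.
- by move=> v A IH *; rewrite IH tren_tsubst.
Qed.

Lemma comp_tren_id (d : nat -> ty) : tren id \o d = d.
Proof. by apply: funext => i; exact: tren_id. Qed.

Lemma vsubst_vup d g g' : vsubst d (vup g) \o vup g' = vup (vsubst d g \o g').
Proof.
apply: funext => -[|x] //=; rewrite subst_ren.1 ren_subst.1.
by rewrite comp_tren_id.
Qed.

Lemma subst_subst :
  (forall v d g d' g',
     vsubst d g (vsubst d' g' v) = vsubst (tsubst d \o d') (vsubst d g \o g') v) /\
  (forall e d g d' g',
     esubst d g (esubst d' g' e) = esubst (tsubst d \o d') (vsubst d g \o g') e).
Proof.
apply: term_ind => //=.
- by move=> v w IHv IHw *; rewrite IHv IHw.
- by move=> e IH *; rewrite IH vsubst_vup.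
- by move=> j v IH *; rewrite IH.
- move=> e IH d g d' g'; rewrite IH tsubst_tup; congr (TLam (esubst _ _ _)).
  by apply: funext => x /=; rewrite subst_ren.1 ren_subst.1.
- by move=> v IH *; rewrite IH.
- by move=> v IH *; rewrite IH.
- by move=> v IH *; rewrite IH.
- by move=> v e IHv IHe *; rewrite IHv IHe.
- move=> v es IHv IHes *; rewrite IHv -map_comp; congr Case.
  apply: all_prop_eq_map; apply: all_prop_impl IHes => e IH /=.
  by rewrite IH vsubst_vup.
- by move=> v A IH *; rewrite IH tsubst_tsubst.
Qed.

Lemma vup_Var : vup Var = Var.
Proof. by apply: funext => -[]. Qed.

Lemma subst_id :
  (forall v, vsubst TVar Var v = v) /\ (forall e, esubst TVar Var e = e).
Proof.
apply: term_ind => //=.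
- by move=> v w -> ->.
- by move=> e IH; rewrite vup_Var IH.
- by move=> j v ->.
- by move=> e IH; rewrite tup_TVar IH.
- by move=> v ->.
- by move=> v ->.
- by move=> v ->.
- by move=> v e -> ->.
- move=> v es -> IH; rewrite vup_Var; congr Case; rewrite -[RHS]map_id.
  exact: all_prop_eq_map.
- by move=> v A ->; rewrite tsubst_id.
Qed.

Lemma comp_tsubst_id (d : nat -> ty) : tsubst TVar \o d = d.
Proof. by apply: funext => i; exact: tsubst_id. Qed.

(** Absorbs a beta or case contraction into the closing substitution, so that an induction
    hypothesis about the open body applies to the reduct. [etsubst1_tup] does the same for type
    application. *)
Lemma esubst1_vup v d g e :
  esubst1 v (esubst d (vup g) e) = esubst d (scons v g) e.
Proof.
rewrite /esubst1 subst_subst.2 comp_tsubst_id; congr esubst.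
apply: funext => -[|x] //=; rewrite subst_ren.1.
exact: subst_id.1.
Qed.

Lemma etsubst1_tup C d g e :
  etsubst1 C (esubst (tup d) (vren succn id \o g) e) = esubst (scons C d) g e.
Proof.
rewrite /etsubst1 subst_subst.2; congr esubst; apply: funext => -[|x] //=.
- by rewrite tsubst_tren tsubst_id.
- by rewrite subst_ren.1; exact: subst_id.1.
- by rewrite subst_ren.1; exact: subst_id.1.
Qed.

(** * Typing *)

Scheme val_ty_mut := Minimality for val_ty Sort Prop
with exp_ty_mut := Minimality for exp_ty Sort Prop.
Combined Scheme typing_ind from val_ty_mut, exp_ty_mut.

Lemma all_onth T (P : pred T) s :
  all P s <-> forall j x, onth s j = Some x -> P x.
Proof.
split.
  elim: s => [_ [] //|x s IH /= /andP[Px /IH h] [|j] y /=]; last exact: h.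
  by case=> <-.
elim: s => //= x s IH h; rewrite (h 0%N x) //=.
by apply: IH => j y; exact: (h j.+1).
Qed.

Lemma wf_tren A n m xi : (forall i, (i < n)%N -> (xi i < m)%N) ->
  wf_ty n A -> wf_ty m (tren xi A).
Proof.
elim/ty_nested_ind: A n m xi => //= [i|A B IHA IHB|A B IHA IHB|As IH|A IH] n m xi h.
- exact: h.
- by move=> /andP[/(IHA _ _ _ h)-> /(IHB _ _ _ h)->].
- by move=> /andP[/(IHA _ _ _ h)-> /(IHB _ _ _ h)->].
- elim: As IH => //= A As IHs [IHA /IHs {}IHs] /andP[wA /IHs ->].
  by rewrite andbT; apply: IHA wA => -[|i] //=; exact: h.
- by apply: IH => -[|i] //=; exact: h.
Qed.

Lemma wf_tup n m d : (forall i, (i < n)%N -> wf_ty m (d i)) ->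
  forall i, (i < n.+1)%N -> wf_ty m.+1 (tup d i).
Proof. by move=> h [|i] //= /h; exact: wf_tren. Qed.

Lemma wf_tsubst A n m d : (forall i, (i < n)%N -> wf_ty m (d i)) ->
  wf_ty n A -> wf_ty m (tsubst d A).
Proof.
elim/ty_nested_ind: A n m d => //= [i|A B IHA IHB|A B IHA IHB|As IH|A IH] n m d h.
- exact: h.
- by move=> /andP[/(IHA _ _ _ h)-> /(IHB _ _ _ h)->].
- by move=> /andP[/(IHA _ _ _ h)-> /(IHB _ _ _ h)->].
- elim: As IH => //= A As IHs [IHA /IHs {}IHs] /andP[wA /IHs ->].
  by rewrite andbT; apply: IHA wA; exact: wf_tup.
- by apply: IH; exact: wf_tup.
Qed.

Lemma wf_tsubst1 n A B : wf_ty n B -> wf_ty n.+1 A -> wf_ty n (tsubst1 B A).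
Proof. by move=> wB; apply: wf_tsubst => -[]. Qed.

Lemma wf_Mu_onth n As j A : wf_ty n (Mu As) -> onth As j = Some A -> wf_ty n.+1 A.
Proof. by move=> /= /all_onth; exact. Qed.

Lemma wf_unfold n As j A :
  wf_ty n (Mu As) -> onth As j = Some A -> wf_ty n (tsubst1 (Mu As) A).
Proof. by move=> wM jA; apply: wf_tsubst1 => //; exact: wf_Mu_onth jA. Qed.

Lemma wf_ctx_shift n G : wf_ctx n G -> wf_ctx n.+1 (map (tren succn) G).
Proof. by rewrite /wf_ctx all_map; apply: sub_all => A; exact: wf_tren. Qed.

Lemma typing_wf :
  (forall n G v A, val_ty n G v A -> wf_ctx n G -> wf_ty n A) /\
  (forall n G e A, exp_ty n G e A -> wf_ctx n G -> wf_ty n A).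
Proof.
apply: typing_ind => //=.
- by move=> n G x A xA /all_onth; apply; exact: xA.
- by move=> n G v w A B _ IHv _ IHw wG; rewrite IHv ?IHw.
- by move=> n G e A B wA _ IH wG; rewrite wA IH //= wA.
- by move=> n G e A _ IH wG; apply: IH; exact: wf_ctx_shift.
- by move=> n G v A B _ IH /IH /andP[].
- by move=> n G v A B _ IH /IH /andP[].
- by move=> n G v e A B _ IH _ _ /IH /andP[].
- by move=> n G v A B _ IH wB wG; apply: wf_tsubst1 => //; exact: IH.
Qed.

Definition ren_ok n G m G' xi ze :=
  (forall i, (i < n)%N -> (xi i < m)%N) /\
  (forall x A, onth G x = Some A -> onth G' (ze x) = Some (tren xi A)).

Lemma ren_ok_up n G m G' xi ze A : ren_ok n G m G' xi ze ->
  ren_ok n (A :: G) m (tren xi A :: G') xi (upren ze).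
Proof. by case=> hx hz; split=> // -[|x] B //= => [[<-]|/hz]. Qed.

Lemma ren_ok_tup n G m G' xi ze : ren_ok n G m G' xi ze ->
  ren_ok n.+1 (map (tren succn) G) m.+1 (map (tren succn) G') (upren xi) ze.
Proof.
case=> hx hz; split; first by move=> -[|i] //=; exact: hx.
move=> x A; rewrite !onth_map.
case E: (onth G x) => [B|] //= [<-]; rewrite (hz _ _ E) /= !tren_tren.
by congr (Some (tren _ _)).
Qed.

Lemma typing_ren :
  (forall n G v A, val_ty n G v A -> forall m G' xi ze,
     ren_ok n G m G' xi ze -> val_ty m G' (vren xi ze v) (tren xi A)) /\
  (forall n G e A, exp_ty n G e A -> forall m G' xi ze,
     ren_ok n G m G' xi ze -> exp_ty m G' (eren xi ze e) (tren xi A)).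
Proof.
apply: typing_ind => /=.
- by move=> n G x A xA m G' xi ze [_ hz]; apply: ty_var; exact: hz.
- by move=> *; exact: ty_unit.
- by move=> n G v w A B _ IHv _ IHw m G' xi ze h; apply: ty_pair;
    [exact: IHv|exact: IHw].
- move=> n G e A B wA _ IH m G' xi ze h; apply: ty_lam.
    by apply: wf_tren wA; case: h.
  by apply: IH; exact: ren_ok_up.
- move=> n G j v As A wM jA _ IH m G' xi ze h.
  apply: (@ty_in _ _ _ _ _ (tren (upren xi) A)).
  + by have := @wf_tren (Mu As) _ _ _ h.1 wM.
  + by rewrite onth_map jA.
  + by rewrite -[Mu _]/(tren xi (Mu As)) -tren_tsubst1; exact: IH.
- by move=> n G e A _ IH m G' xi ze h; apply: ty_tlam; apply: IH; exact: ren_ok_tup.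
- by move=> n G v A _ IH m G' xi ze h; apply: ty_ret; exact: IH.
- by move=> *; exact: ty_choose.
- by move=> n G v A B _ IH m G' xi ze h; apply: ty_fst; exact: IH.
- by move=> n G v A B _ IH m G' xi ze h; apply: ty_snd; exact: IH.
- by move=> n G v e A B _ IHv _ IHe m G' xi ze h; apply: ty_app;
    [exact: IHv|exact: IHe].
- move=> n G v es As B _ IHv sz wB _ IHes m G' xi ze h; apply: ty_case.
  + exact: IHv.
  + by rewrite !size_map.
  + by apply: wf_tren wB; case: h.
  + move=> j e A; rewrite !onth_map.
    case E: (onth es j) => [e0|] //= [<-]; case F: (onth As j) => [A0|] //= [<-].
    rewrite -[Mu _]/(tren xi (Mu As)) -tren_tsubst1.
    by apply: (IHes _ _ _ E F); exact: ren_ok_up.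
- move=> n G v A B _ IH wB m G' xi ze h; rewrite tren_tsubst1; apply: ty_tapp.
  + exact: IH.
  + by apply: wf_tren wB; case: h.
Qed.

Definition subst_ok n G m G' d g :=
  (forall i, (i < n)%N -> wf_ty m (d i)) /\
  (forall x A, onth G x = Some A -> val_ty m G' (g x) (tsubst d A)).

Lemma subst_ok_up n G m G' d g A : subst_ok n G m G' d g ->
  subst_ok n (A :: G) m (tsubst d A :: G') d (vup g).
Proof.
case=> hd hg; split=> // -[|x] B /= => [[<-]|/hg]; first exact: ty_var.
move=> t; rewrite -[tsubst d B]tren_id; apply: typing_ren.1 t _ _ _ _ _.
by split=> // y C /= ->; rewrite tren_id.
Qed.

Lemma subst_ok_tup n G m G' d g : subst_ok n G m G' d g ->
  subst_ok n.+1 (map (tren succn) G) m.+1 (map (tren succn) G') (tup d)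
    (vren succn id \o g).
Proof.
case=> hd hg; split; first exact: wf_tup.
move=> x A; rewrite !onth_map; case E: (onth G x) => [B|] //= [<-].
rewrite tsubst_tren; have -> : tup d \o succn = tren succn \o d by [].
rewrite -tren_tsubst; apply: typing_ren.1 (hg _ _ E) _ _ _ _ _.
by split=> // y C yC; rewrite onth_map yC.
Qed.

Lemma typing_subst :
  (forall n G v A, val_ty n G v A -> forall m G' d g,
     subst_ok n G m G' d g -> val_ty m G' (vsubst d g v) (tsubst d A)) /\
  (forall n G e A, exp_ty n G e A -> forall m G' d g,
     subst_ok n G m G' d g -> exp_ty m G' (esubst d g e) (tsubst d A)).
Proof.
apply: typing_ind => /=.
- by move=> n G x A xA m G' d g [_ hz]; exact: hz.
- by move=> *; exact: ty_unit.
- by move=> n G v w A B _ IHv _ IHw m G' d g h; apply: ty_pair;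
    [exact: IHv|exact: IHw].
- move=> n G e A B wA _ IH m G' d g h; apply: ty_lam.
    by apply: wf_tsubst wA; case: h.
  by apply: IH; exact: subst_ok_up.
- move=> n G j v As A wM jA _ IH m G' d g h.
  apply: (@ty_in _ _ _ _ _ (tsubst (tup d) A)).
  + by have := @wf_tsubst (Mu As) _ _ _ h.1 wM.
  + by rewrite onth_map jA.
  + by rewrite -[Mu _]/(tsubst d (Mu As)) -tsubst_tsubst1; exact: IH.
- by move=> n G e A _ IH m G' d g h; apply: ty_tlam; apply: IH; exact: subst_ok_tup.
- by move=> n G v A _ IH m G' d g h; apply: ty_ret; exact: IH.
- by move=> *; exact: ty_choose.
- by move=> n G v A B _ IH m G' d g h; apply: ty_fst; exact: IH.
- by move=> n G v A B _ IH m G' d g h; apply: ty_snd; exact: IH.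
- by move=> n G v e A B _ IHv _ IHe m G' d g h; apply: ty_app;
    [exact: IHv|exact: IHe].
- move=> n G v es As B _ IHv sz wB _ IHes m G' d g h; apply: ty_case.
  + exact: IHv.
  + by rewrite !size_map.
  + by apply: wf_tsubst wB; case: h.
  + move=> j e A; rewrite !onth_map.
    case E: (onth es j) => [e0|] //= [<-]; case F: (onth As j) => [A0|] //= [<-].
    rewrite -[Mu _]/(tsubst d (Mu As)) -tsubst_tsubst1.
    by apply: (IHes _ _ _ E F); exact: subst_ok_up.
- move=> n G v A B _ IH wB m G' d g h; rewrite tsubst_tsubst1; apply: ty_tapp.
  + exact: IH.
  + by apply: wf_tsubst wB; case: h.
Qed.

(** * Reduction *)

Lemma step_ret b v e : ~ step b (Ret v) e.
Proof. by move=> s; inversion s. Qed.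

Lemma step_fill E b e e' : step b e e' -> step b (fill E e) (fill E e').
Proof. by elim: E => //= v E IH s; apply: step_app; exact: IH. Qed.

Lemma fill_ret E e v : fill E e = Ret v -> e = Ret v.
Proof. by case: E. Qed.

(** A returned value in the hole is excluded because the innermost frame could then contract with
    it. *)
Lemma step_fill_inv E b e e2 : (forall v, e <> Ret v) -> step b (fill E e) e2 ->
  exists2 e', e2 = fill E e' & step b e e'.
Proof.
move=> eN; elim: E e2 => [|v E IH] e2 /= s; first by exists e2.
inversion s; subst; first by case: (eN v0); apply: (@fill_ret E).
by have [e1 -> s1] := IH _ ltac:(eassumption); exists e1.
Qed.

Fixpoint ecat E F := if E is AppR v E' then AppR v (ecat E' F) else F.

Lemma fill_ecat E F e : fill (ecat E F) e = fill E (fill F e).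
Proof. by elim: E => //= v E ->. Qed.

Lemma must_intro e : (forall e', red e e' -> must e') -> must e.
Proof.
move=> h [f [f0 fS]]; apply: (h (f 1%N)); first by rewrite -f0; exact: fS.
by exists (f \o succn); split=> // i; exact: fS.
Qed.

Lemma must_ret v : must (Ret v).
Proof. by apply: must_intro => e' [b /step_ret]. Qed.

Lemma must_fill E e : (forall v, e <> Ret v) ->
  (forall b e', step b e e' -> must (fill E e')) -> must (fill E e).
Proof.
move=> eN h; apply: must_intro => e2 [b /step_fill_inv-/(_ eN)[e' -> s]].
exact: h s.
Qed.

(** A non-accessible expression has a non-accessible reduct; iterating a choice of such reducts
    would give an infinite reduction sequence. *)
Lemma must_Acc e : must e -> Acc (fun e2 e1 => red e1 e2) e.
Proof.
move=> m; apply: contrapT => nA.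
have next (e1 : {e | ~ Acc (fun e2 e1 => red e1 e2) e}) :
    exists e2 : {e | ~ Acc (fun e2 e1 => red e1 e2) e}, red (sval e1) (sval e2).
  case: e1 => e1 n1 /=; apply: contrapT => h; apply: n1; constructor => e2 r.
  by apply: contrapT => n2; apply: h; exists (exist _ e2 n2).
have [f fP] := choice next; apply: m.
exists (fun i => sval (iter i f (exist _ e nA))).
by split=> // i; exact: fP.
Qed.

(** Reduction made functional: [k] is the number that [Choose] picks, and stuck expressions are left
    alone. Every reduct is thus named by a list of numbers, whence there are only countably many. *)
Fixpoint reduct (e : exp) (k : nat) : exp :=
  match e with
  | Fst (Pair v w) => Ret v
  | Snd (Pair v w) => Ret w
  | App (Lam e1) (Ret v) => esubst1 v e1
  | App v e1 => App v (reduct e1 k)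
  | TApp (TLam e1) A => etsubst1 A e1
  | Choose => Ret (num k)
  | Case (In j v) es => if onth es j is Some e1 then esubst1 v e1 else e
  | _ => e
  end.

Lemma reduct_complete b e e' : step b e e' -> exists k, reduct e k = e'.
Proof.
elim=> {b e e'} /=; try by exists 0%N.
- by move=> n; exists n.
- by move=> j v es e ->; exists 0%N.
- move=> b v e e' s [k <-]; exists k.
  (* [reduct] would contract a beta-redex here if [e] were a returned value, but [e] takes a
     step. *)
  by case: v => //= e1; case: e s => // w /step_ret.
Qed.

Lemma red_star_reduct e e' : clos_refl_trans exp red e e' ->
  exists l, foldl reduct e l = e'.
Proof.
elim=> {e e'} [e e' [b /reduct_complete[k <-]]|e|e1 e2 e3 _ [l <-] _ [l' <-]].
- by exists [:: k].
- by exists [::].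
- by exists (l ++ l'); rewrite foldl_cat.
Qed.

Lemma false_star_red e e' : clos_refl_trans exp (step false) e e' ->
  clos_refl_trans exp red e e'.
Proof.
elim=> {e e'} [e e' s|e|e1 e2 e3 _ h _ h'].
- by apply: rt_step; exists false.
- exact: rt_refl.
- exact: rt_trans h h'.
Qed.

Lemma red_star_plus e1 e2 e3 : clos_refl_trans exp red e1 e2 ->
  clos_trans exp (fun x y => red y x) e3 e2 ->
  clos_trans exp (fun x y => red y x) e3 e1.
Proof.
elim=> {e1 e2} [e1 e2 s|//|e1 e2 e4 _ IH _ IH' h] => [h|].
  by apply: t_trans h _; exact: t_step.
by apply: IH; exact: IH'.
Qed.

Lemma red_plus_star e1 e2 e3 : clos_refl_trans exp red e2 e3 ->
  clos_trans exp (fun x y => red y x) e2 e1 ->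
  clos_trans exp (fun x y => red y x) e3 e1.
Proof.
elim=> {e2 e3} [e2 e3 s|//|e2 e3 e4 _ IH _ IH' h] => [h|].
  by apply: t_trans h; exact: t_step.
by apply: IH'; exact: IH.
Qed.

(** The unfold-fold step makes the sequence nonempty, so that accessibility for the transitive
    closure supports induction along [red1]. *)
Lemma red1_plus e e' : red1 e e' -> clos_trans exp (fun x y => red y x) e' e.
Proof.
move=> [e1 [e2 [/false_star_red s1 s /false_star_red s2]]].
apply: red_star_plus s1 _; apply: red_plus_star s2 _.
by apply: t_step; exists true.
Qed.

Lemma red1_star e e' : red1 e e' -> clos_refl_trans exp red e e'.
Proof.
move=> [e1 [e2 [/false_star_red s1 s /false_star_red s2]]].
by apply: rt_trans s1 (rt_trans _ _ _ _ _ _ s2); apply: rt_step; exists true.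
Qed.

(** * Ordinals *)

Section Ordinals.
Context {disp : Order.disp_t} {W : orderType disp}.
Implicit Types b c : W.

(** Such a step can be prepended to any [red1] sequence of the reduct, so it costs no index. An
    unfold-fold step is itself a [red1] sequence, so in [conv_true] the index drops. *)
Lemma conv_false b e e' : step false e e' -> conv b e -> conv b e'.
Proof.
move=> s h; inversion h as [b' e1 hb]; subst; constructor=> e2 [e3 [e4 [s3 s4 s5]]].
apply: hb; exists e3, e4; split=> //.
by apply: rt_trans s3; exact: rt_step.
Qed.

Lemma conv_true b e e' : step true e e' -> conv b e -> exists2 c, c < b & conv c e'.
Proof.
move=> s h; inversion h as [b' e1 hb]; subst; apply: hb.
by exists e, e'; split=> //; exact: rt_refl.
Qed.

Hypothesis omega1_W : is_omega1 W.

Lemma omega1_min (P : set W) : (exists b, P b) ->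
  exists2 b, P b & forall c, P c -> b <= c.
Proof.
case: omega1_W => wo _ _ [b Pb].
have [|m [[mP mlb] _]] := wo [pred c | `[< P c >]]; first by exists b; apply/asboolP.
by exists m; [exact/asboolP|move=> c Pc; apply: mlb; apply/asboolP].
Qed.

Lemma omega1_wf : well_founded (fun b c : W => b < c).
Proof.
move=> b; apply: contrapT => nb.
have [m nm mlb] :=
  @omega1_min (fun b => ~ Acc (fun b c : W => b < c) b) (ex_intro _ b nb).
apply: nm; constructor=> c cm; apply: contrapT => /mlb.
by rewrite leNgt cm.
Qed.

Lemma omega1_ind (P : W -> Prop) :
  (forall b, (forall c, c < b -> P c) -> P b) -> forall b, P b.
Proof. by move=> h b; elim: (omega1_wf b) => {}b _; exact: h. Qed.

Lemma countable_lower b : countable [set c | c <= b].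
Proof.
case: omega1_W => _ seg _.
apply: (sub_countable (B := [set c | c < b] `|` [set b])%classic).
  apply: subset_card_le => c /=; rewrite le_eqVlt => /orP[/eqP|]; first by right.
  by left.
rewrite -bigcup2E; apply: bigcup_countable => // -[|[|i]] _ //=; exact: countable1.
Qed.

(** Otherwise [W] would be a countable union of the lower sets of the [f k], each of which is
    countable. The index type [seq nat] is the one that names reducts. *)
Lemma omega1_bounded (f : seq nat -> W) : exists b, forall k, f k < b.
Proof.
case: omega1_W => _ seg unc; apply: contrapT => /forallNP h; apply: unc.
have := @bigcup_countable _ _ setT (fun k => [set c | c <= f k])%classic
  (countableP setT) (fun k _ => countable_lower _).
apply: sub_countable; apply: subset_card_le => b _.
have /existsNP[l /negP] := h b; rewrite -leNgt => fb.
by exists l.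
Qed.

(** Bounding a constant family strictly shows that there is no greatest element; the least element
    above [b] is its successor. *)
Lemma omega1_succ b : exists c, is_succ b c.
Proof.
have [c bc] := omega1_bounded (fun=> b).
have [m bm mlb] := @omega1_min (fun c => b < c) (ex_intro _ c (bc [::])).
by exists m; split.
Qed.

Lemma omega1_cases b : [\/ is_zero b, exists c, is_succ c b | is_limit b].
Proof.
have [b0|b0] := pselect (is_zero b); first by constructor 1.
have [bS|bS] := pselect (exists c, is_succ c b); first by constructor 2.
by constructor 3; split.
Qed.

Lemma succ_lt b c a : is_succ b c -> (a < c) = (a <= b).
Proof.
move=> [bc cmin]; apply/idP/idP => [ac|ab]; last exact: le_lt_trans bc.
by rewrite leNgt; apply/negP => /cmin; rewrite leNgt ac.
Qed.

Lemma limit_lt l b c : is_limit l -> b < l -> is_succ b c -> c < l.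
Proof.
move=> [_ nS] bl bc; rewrite lt_neqAle bc.2 // andbT.
by apply/eqP => cl; apply: nS; exists b; rewrite -cl.
Qed.

(** Well-founded induction along reduction: each of the countably many [red1] reducts has an index,
    and these indices have a common strict bound in [W]. *)
Lemma must_conv e : must e -> exists b : W, conv b e.
Proof.
move=> /must_Acc/(Acc_clos_trans _ _ _) acc; elim: {e}acc => e _ IH.
(* Supplies a default index for the lists that do not name a [red1] reduct. *)
have b0 : inhabited W.
  apply: contrapT => nW; case: omega1_W => _ _; apply.
  apply: (sub_countable (B := set0)); last exact: countable0.
  by apply: subset_card_le => b; case: nW.
have /choice[f fP] (k : seq nat) : exists b : W,
    red1 e (foldl reduct e k) -> conv b (foldl reduct e k).
  case: (pselect (red1 e (foldl reduct e k))) => r.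
    by have [c ck] := IH _ (red1_plus r); exists c.
  by case: b0 => b; exists b.
have [b fb] := omega1_bounded f; exists b; constructor => e' r.
by have [l le] := red_star_reduct (red1_star r); exists (f l); rewrite // -le;
  apply: fP; rewrite le.
Qed.

(** Transfinite induction on the larger index: nothing lies below zero, a successor passes through
    its predecessor, and a limit is an intersection. *)
Lemma uniform_vrel A A' (r : Defs.family (W := W)) : uniform A A' r -> vrel A A' r.
Proof.
move=> [vals r0 rS rl]; split=> // b c v v'; elim/omega1_ind: c b => c IH b.
rewrite le_eqVlt => /orP[/eqP->//|bc].
case: (omega1_cases c) => [c0|[a ac]|lc] rc.
- by have := c0 b; rewrite leNgt bc.
- by apply: (IH a); [exact: ac.1|rewrite -(succ_lt b ac)|exact: rS rc].
- by move: (rl _ v v' lc) => [/(_ rc)/(_ b bc)].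
Qed.

End Ordinals.

(** * The logical relation *)

Section Interp.
Context {disp : Order.disp_t} {W : orderType disp}.
Notation family := (Defs.family (W := W)).
Notation rel_env := (rel_env (W := W)).
Implicit Types (b c : W) (r s t : family) (rho : rel_env).

(** This and the next two definitions abstract the clauses of [interp] over the interpretations of
    the components, so that equalities between those can be rewritten. The clauses are instances by
    conversion. *)
Definition arr_rel (M M' B B' : ty) (r s : family) : family :=
  fun b v v' => exists e e',
    [/\ v = Lam e, v' = Lam e', cval M v, cval M' v' &
        forall c w w', c <= b -> r c w w' ->
          bitop_rel B B' s c (esubst1 w e) (esubst1 w' e')].

Definition all_rel (M M' : ty) (S S' : rel_entry -> ty)
    (F : rel_entry -> family) : family :=
  fun b v v' => exists e e',
    [/\ v = TLam e, v' = TLam e', cval M v, cval M' v' &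
        forall C C' s, closed_ty C -> closed_ty C' -> vrel C C' s ->
          bitop_rel (S (Entry C C' s)) (S' (Entry C C' s)) (F (Entry C C' s)) b
            (etsubst1 C e) (etsubst1 C' e')].

Definition mu_rel (M M' : ty) (Fs : seq (family -> family)) : family :=
  fun b v v' => exists2 t, mu_solution M M' Fs t & t b v v'.

Definition mu_maps (As : seq ty) rho : seq (family -> family) :=
  map (fun B t => interp B
    (scons (Entry (tsubst (srcs rho) (Mu As)) (tsubst (tgts rho) (Mu As)) t) rho))
    As.

Lemma interp_arr A B rho : interp (Arr A B) rho =
  arr_rel (tsubst (srcs rho) (Arr A B)) (tsubst (tgts rho) (Arr A B))
    (tsubst (srcs rho) B) (tsubst (tgts rho) B) (interp A rho) (interp B rho).
Proof. by []. Qed.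

Lemma interp_all B rho : interp (All B) rho =
  all_rel (tsubst (srcs rho) (All B)) (tsubst (tgts rho) (All B))
    (fun x => tsubst (srcs (scons x rho)) B)
    (fun x => tsubst (tgts (scons x rho)) B) (fun x => interp B (scons x rho)).
Proof. by []. Qed.

Lemma interp_mu As rho : interp (Mu As) rho =
  mu_rel (tsubst (srcs rho) (Mu As)) (tsubst (tgts rho) (Mu As)) (mu_maps As rho).
Proof. by []. Qed.

(** * Compositionality of the interpretation under renaming and substitution *)

Lemma srcs_scons x rho : srcs (scons x rho) = scons (src x) (srcs rho).
Proof. exact: scons_comp. Qed.

Lemma tgts_scons x rho : tgts (scons x rho) = scons (tgt x) (tgts rho).
Proof. exact: scons_comp. Qed.

Lemma interp_tren A xi rho : interp (tren xi A) rho = interp A (rho \o xi).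
Proof.
elim/ty_nested_ind: A xi rho => //= [A B IHA IHB|A B IHA IHB|As IH|A IH] xi rho.
- by rewrite IHA IHB.
- rewrite -[LHS]/(interp (Arr _ _) _) -[RHS]/(interp (Arr _ _) _) !interp_arr.
  by rewrite IHA IHB -[Arr _ _]/(tren xi (Arr A B)) !tsubst_tren.
- rewrite -[LHS]/(interp (Mu _) _) -[RHS]/(interp (Mu _) _) !interp_mu.
  rewrite /mu_maps -[Mu (map _ _)]/(tren xi (Mu As)) !tsubst_tren.
  rewrite -map_comp; congr mu_rel.
  apply: all_prop_eq_map; apply: all_prop_impl IH => A IH /=.
  by apply: funext => t; rewrite IH scons_upren.
- rewrite -[LHS]/(interp (All _) _) -[RHS]/(interp (All _) _) !interp_all.
  rewrite -[All _]/(tren xi (All A)) !tsubst_tren.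
  congr all_rel; apply: funext => x; rewrite ?IH ?scons_upren //.
  + by rewrite tsubst_tren !srcs_scons scons_upren.
  + by rewrite tsubst_tren !tgts_scons scons_upren.
Qed.

(** The semantic counterpart of [d]. It is also the environment that specializes the logical
    relation to a given closing type substitution. *)
Definition env_subst (d : nat -> ty) rho : rel_env :=
  fun i => Entry (tsubst (srcs rho) (d i)) (tsubst (tgts rho) (d i))
             (interp (d i) rho).

Lemma env_subst_tup d rho x :
  env_subst (tup d) (scons x rho) = scons x (env_subst d rho).
Proof.
apply: funext => -[|i] /=; first by case: x.
by rewrite /env_subst /= !tsubst_tren interp_tren.
Qed.

Lemma interp_tsubst A d rho :
  interp (tsubst d A) rho = interp A (env_subst d rho).
Proof.
elim/ty_nested_ind: A d rho => //= [A B IHA IHB|A B IHA IHB|As IH|A IH] d rho.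
- by rewrite IHA IHB.
- rewrite -[LHS]/(interp (Arr _ _) _) -[RHS]/(interp (Arr _ _) _) !interp_arr.
  by rewrite IHA IHB -[Arr _ _]/(tsubst d (Arr A B)) !tsubst_tsubst.
- rewrite -[LHS]/(interp (Mu _) _) -[RHS]/(interp (Mu _) _) !interp_mu.
  rewrite /mu_maps -[Mu (map _ _)]/(tsubst d (Mu As)) !tsubst_tsubst.
  rewrite -map_comp; congr mu_rel.
  apply: all_prop_eq_map; apply: all_prop_impl IH => A IH /=.
  by apply: funext => t; rewrite IH env_subst_tup.
- rewrite -[LHS]/(interp (All _) _) -[RHS]/(interp (All _) _) !interp_all.
  rewrite -[All _]/(tsubst d (All A)) !tsubst_tsubst.
  congr all_rel; apply: funext => x; rewrite ?IH ?env_subst_tup //.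
  + by rewrite tsubst_tsubst -env_subst_tup.
  + by rewrite tsubst_tsubst -env_subst_tup.
Qed.

Lemma interp_tsubst1 A B rho : interp (tsubst1 B A) rho =
  interp A (scons (Entry (tsubst (srcs rho) B) (tsubst (tgts rho) B)
                     (interp B rho)) rho).
Proof.
rewrite interp_tsubst; congr interp; apply: funext => -[|i] //=.
by rewrite /env_subst /= /srcs /tgts /=; case: (rho i).
Qed.

Lemma srcs_tsubst1 A B rho : tsubst (srcs rho) (tsubst1 B A) =
  tsubst (scons (tsubst (srcs rho) B) (srcs rho)) A.
Proof. by rewrite /tsubst1 tsubst_tsubst scons_comp. Qed.

Lemma tgts_tsubst1 A B rho : tsubst (tgts rho) (tsubst1 B A) =
  tsubst (scons (tsubst (tgts rho) B) (tgts rho)) A.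
Proof. by rewrite /tsubst1 tsubst_tsubst scons_comp. Qed.

(** * Dependence on initial segments of indices, and the solution of recursive types *)

Lemma bitop_mono A A' r b c e e' :
  c <= b -> bitop_rel A A' r b e e' -> bitop_rel A A' r c e e'.
Proof.
move=> cb [eA eA' h]; split=> // a E E' ac; apply: h; exact: le_trans cb.
Qed.

Definition agree_upto b r s := forall c v v', c <= b -> r c v v' <-> s c v v'.

Lemma agree_upto_sym b r s : agree_upto b r s -> agree_upto b s r.
Proof. by move=> h c v v' /(h c v v')[]. Qed.

Lemma agree_upto_le b c r s : c <= b -> agree_upto b r s -> agree_upto c r s.
Proof. by move=> cb h a v v' ac; apply: h; exact: le_trans cb. Qed.

(** Both orthogonals at [b] inspect the relation at indices up to [b] only. *)
Lemma bitop_agree A A' r s b e e' : agree_upto b r s ->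
  bitop_rel A A' r b e e' -> bitop_rel A A' s b e e'.
Proof.
move=> rs [eA eA' h]; split=> // c E E' cb [EA EA' top]; apply: (h) => //.
split=> // a v v' ac rv; apply: top => //.
by apply: (rs _ _ _ (le_trans ac cb)).1.
Qed.

Lemma wf_env_scons n rho C C' s : closed_ty C -> closed_ty C' -> vrel C C' s ->
  wf_env n rho -> wf_env n.+1 (scons (Entry C C' s) rho).
Proof. by move=> wC wC' vs wrho [|i] //=; exact: wrho. Qed.

Lemma wf_srcs n rho A : wf_env n rho -> wf_ty n A -> closed_ty (tsubst (srcs rho) A).
Proof. by move=> wrho; apply: wf_tsubst => i /wrho[]. Qed.

Lemma wf_tgts n rho A : wf_env n rho -> wf_ty n A -> closed_ty (tsubst (tgts rho) A).
Proof. by move=> wrho; apply: wf_tsubst => i /wrho[]. Qed.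

Hypothesis omega1_W : is_omega1 W.

Lemma interp_vrel A n rho : wf_ty n A -> wf_env n rho ->
  vrel (tsubst (srcs rho) A) (tsubst (tgts rho) A) (interp A rho).
Proof.
elim/ty_nested_ind: A n rho => [i|||||].
- by move=> n rho /= /[swap] wrho /wrho[].
- by move=> n rho _ _; split=> // b v v' [-> ->]; split; exact: ty_unit.
- move=> A B IHA IHB n rho /= /andP[wA wB] wrho.
  have [vA mA] := IHA _ _ wA wrho; have [vB mB] := IHB _ _ wB wrho.
  split=> [b v v'|b c v v' bc].
    move=> [v1 [v2 [v1' [v2' [-> -> /vA[t1 t1'] /vB[t2 t2']]]]]].
    by split; exact: ty_pair.
  move=> [v1 [v2 [v1' [v2' [-> -> h1 h2]]]]]; exists v1, v2, v1', v2'.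
  by split=> //; [exact: mA h1|exact: mB h2].
- move=> A B _ _ n rho _ _; split=> [b v v' [e [e' []]] //|b c v v' bc].
  move=> [e [e' [-> -> t t' h]]]; exists e, e'; split=> // a w w' ab.
  by apply: h; exact: le_trans bc.
- move=> As _ n rho _ _; split=> [b v v'|b c v v' bc] [t sol].
    by case: (sol) => -[vals _ _ _] _; exact: vals.
  exists t => //; case: (sol) => /(uniform_vrel omega1_W)[_ mono] _.
  exact: mono bc _.
- move=> A _ n rho _ _; split=> [b v v' [e [e' []]] //|b c v v' bc].
  move=> [e [e' [-> -> t t' h]]]; exists e, e'; split=> // C C' s wC wC' vs.
  by apply: bitop_mono bc _; exact: h.
Qed.

(* [Fs] and [Gs] are the summands of one recursive type in two environments that
   agree up to [b]. *)
Definition maps_below b (M M' : ty) (Fs Gs : seq (family -> family)) :=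
  forall j F, onth Fs j = Some F -> exists2 G, onth Gs j = Some G &
    forall c r s, c <= b -> vrel M M' r -> vrel M M' s -> agree_upto c r s ->
      forall v v', F r c v v' -> G s c v v'.

(** Transfinite induction: at zero both are total on well-typed values, at a successor both are
    determined by their parts up to the predecessor, at a limit both are intersections. With
    [Fs = Gs] this is uniqueness. *)
Lemma mu_solution_agree b M M' Fs Gs r s :
  maps_below b M M' Fs Gs -> maps_below b M M' Gs Fs ->
  mu_solution M M' Fs r -> mu_solution M M' Gs s -> agree_upto b r s.
Proof.
move=> FG GF [ur rS] [us sS].
have vr := uniform_vrel omega1_W ur; have vs := uniform_vrel omega1_W us.
move=> c; elim/(omega1_ind omega1_W): c => c IH v v' cb.
case: (omega1_cases c) => [c0|[a ac]|lc].
- case: ur us => [vals r0 _ _] [vals' s0 _ _].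
  by split=> [/vals[? ?]|/vals'[? ?]]; [exact: s0|exact: r0].
- have ab : a <= b by apply: le_trans cb; apply: ltW; case: ac.
  have rs : agree_upto a r s.
    move=> d w w' da; apply: IH; first by rewrite (succ_lt _ ac).
    exact: le_trans ab.
  rewrite (rS _ _ ac) (sS _ _ ac); split.
    move=> [j [F [w [w' [jF -> -> Fw]]]]]; have [H jH FH] := FG _ _ jF.
    by exists j, H, w, w'; split=> //; exact: FH Fw.
  move=> [j [F [w [w' [jF -> -> Fw]]]]]; have [H jH FH] := GF _ _ jF.
  exists j, H, w, w'; split=> //; apply: FH Fw => //.
  exact: agree_upto_sym.
- case: ur us => [_ _ _ rl] [_ _ _ sl]; rewrite rl // sl //.
  by split=> h a ac; have [rs sr] := IH a ac v v' (le_trans (ltW ac) cb);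
    [apply: rs|apply: sr]; exact: h.
Qed.

(** Well-founded recursion on the index, asking at [b] for the successor clause of every [a < b].
    The summands take a whole family while the recursion provides only indices below [b], so they
    are first given the family truncated at [a]. *)
Lemma mu_solution_exists M M' Fs :
  (forall j F t, onth Fs j = Some F -> vrel M M' t ->
     (forall b v v', F t b v v' -> cval M (In j v) /\ cval M' (In j v')) /\
     (forall b c v v', b <= c -> F t c v v' -> F t b v v')) ->
  (forall b, maps_below b M M' Fs Fs) ->
  exists t, mu_solution M M' Fs t.
Proof.
move=> FP FF.
pose body b (rec : forall c, c < b -> value -> value -> Prop) v v' :=
  [/\ cval M v, cval M' v' & forall a, a < b -> exists j F w w',
     [/\ onth Fs j = Some F, v = In j w, v' = In j w' &
       F (fun c x x' => exists cb : c < b, c <= a /\ rec c cb x x') a w w']].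
pose t : family := Fix (omega1_wf omega1_W) (fun=> value -> value -> Prop) body.
have tE b v v' : t b v v' <-> [/\ cval M v, cval M' v' &
    forall a, a < b -> exists j F w w',
     [/\ onth Fs j = Some F, v = In j w, v' = In j w' &
       F (fun c x x' => c <= a /\ t c x x') a w w']].
  rewrite {1}/t Fix_eq; last first.
    move=> a f g fg; congr body; apply: functional_extensionality_dep => c.
    by apply: functional_extensionality_dep => ca; exact: fg.
  have E a : a < b -> (fun c x x' => exists _ : c < b, c <= a /\ t c x x') =
                     (fun c x x' => c <= a /\ t c x x').
    move=> ab; apply: funext => c; apply: funext => x; apply: funext => x'.
    apply: propext; split=> [[_ //]|[ca h]].
    by exists (le_lt_trans ca ab).
  by split=> -[tv tv' h]; split=> // a ab; move: (h a ab); rewrite (E a ab).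
have vt : vrel M M' t.
  split=> [b v v' /tE[] //|b c v v' bc /tE[tv tv' h]].
  by apply/tE; split=> // a ab; apply: h; exact: lt_le_trans bc.
(* The truncation disappears, since it agrees with [t] up to [a] and the summands at [a] see no more
   than that. *)
have tE' b v v' : t b v v' <-> [/\ cval M v, cval M' v' &
    forall a, a < b -> exists j F w w',
     [/\ onth Fs j = Some F, v = In j w, v' = In j w' & F t a w w']].
  have vta a : vrel M M' (fun c x x' => c <= a /\ t c x x').
    split=> [c x x' [_ /vt.1]//|c d x x' cd [da h]].
    by split; [exact: le_trans da|exact: vt.2 h].
  rewrite tE; split=> -[tv tv' h]; split=> // a /h[j [F [w [w' [jF -> -> Fw]]]]].
    have [G jG FG] := FF a _ _ jF; exists j, G, w, w'; split=> //.
    by apply: FG Fw => // c x x' ca; split=> [[]|].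
  have [G jG FG] := FF a _ _ jF; exists j, G, w, w'; split=> //.
  by apply: FG Fw => // c x x' ca; split=> [|[]].
exists t; split; last first.
  move=> b c bc v v'; split.
    by move=> /tE'[_ _]; apply; case: bc.
  (* Only the clause at the predecessor [b] is given; those at earlier indices follow by
     monotonicity of [F t]. *)
  move=> [j [F [w [w' [jF -> -> Fw]]]]]; have [Fval Fmono] := FP _ _ _ jF vt.
  have [tv tv'] := Fval _ _ _ Fw; apply/tE'; split=> // a ac.
  exists j, F, w, w'; split=> //; apply: Fmono Fw.
  by rewrite -(succ_lt _ bc).
split; first by case: vt.
- move=> b v v' b0 tv tv'; apply/tE'; split=> // a.
  by rewrite ltNge b0.
- by move=> b c v v' bc; apply: vt.2; apply: ltW; case: bc.
- move=> l v v' ll; split=> [h b bl|h]; first by apply: vt.2 (ltW bl) h.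
  (* A limit is not zero, so some index lies below it; the relation there yields the typings of [v]
     and [v']. *)
  have [a al] : exists a, a < l.
    apply: contrapT => /forallNP h'; apply: ll.1 => c.
    by rewrite leNgt; apply/negP; exact: h'.
  have [tv tv'] := vt.1 _ _ _ (h a al).
  (* The successor of [a] is still below the limit, and the relation at it contains the clause for
     [a]. *)
  apply/tE'; split=> // {}a {}al; have [c ac] := omega1_succ omega1_W a.
  have /tE'[_ _] := h c (limit_lt ll al ac).
  by apply; case: ac.
Qed.

Definition env_agree b rho rho' := forall i, [/\ src (rho i) = src (rho' i),
  tgt (rho i) = tgt (rho' i) & agree_upto b (rel_of (rho i)) (rel_of (rho' i))].

Lemma env_agree_sym b rho rho' : env_agree b rho rho' -> env_agree b rho' rho.
Proof. by move=> h i; have [-> -> hi] := h i; split=> //; exact: agree_upto_sym. Qed.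

Lemma env_agree_le b c rho rho' :
  c <= b -> env_agree b rho rho' -> env_agree c rho rho'.
Proof.
by move=> cb h i; have [-> -> hi] := h i; split=> //; exact: agree_upto_le hi.
Qed.

Lemma env_agree_scons b rho rho' C C' r s : agree_upto b r s ->
  env_agree b rho rho' ->
  env_agree b (scons (Entry C C' r) rho) (scons (Entry C C' s) rho').
Proof. by move=> rs h [|i] //=; exact: h. Qed.

Lemma env_agree_srcs b rho rho' : env_agree b rho rho' -> srcs rho = srcs rho'.
Proof. by move=> h; apply: funext => i; have [] := h i. Qed.

Lemma env_agree_tgts b rho rho' : env_agree b rho rho' -> tgts rho = tgts rho'.
Proof. by move=> h; apply: funext => i; have [] := h i. Qed.

(** Non-expansiveness of the interpretation in its environment, for agreement on initial
    segments. *)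
Definition is_local (A : ty) := forall n rho rho' b, wf_ty n A ->
  wf_env n rho -> wf_env n rho' -> env_agree b rho rho' ->
  agree_upto b (interp A rho) (interp A rho').

Lemma mu_maps_below n As rho rho' b : all_prop is_local As -> wf_ty n (Mu As) ->
  wf_env n rho -> wf_env n rho' -> env_agree b rho rho' ->
  maps_below b (tsubst (srcs rho) (Mu As)) (tsubst (tgts rho) (Mu As))
    (mu_maps As rho) (mu_maps As rho').
Proof.
move=> lAs wM wrho wrho' ag j F; rewrite !onth_map.
case jA: (onth As j) => [A|] //= [<-]; eexists; first by [].
rewrite -(env_agree_srcs ag) -(env_agree_tgts ag).
have wMs := wf_srcs wrho wM; have wMt := wf_tgts wrho wM.
move=> c r s cb vr vs rs v v'.
have wA := wf_Mu_onth wM jA.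
have [h _] := all_prop_onth lAs jA _ _ _ _ wA (wf_env_scons wMs wMt vr wrho)
  (wf_env_scons wMs wMt vs wrho')
  (env_agree_scons _ _ rs (env_agree_le cb ag)) _ v v' (le_refl c).
exact: h.
Qed.

Lemma mu_maps_solution n As rho : all_prop is_local As -> wf_ty n (Mu As) ->
  wf_env n rho ->
  exists t, mu_solution (tsubst (srcs rho) (Mu As)) (tsubst (tgts rho) (Mu As))
    (mu_maps As rho) t.
Proof.
move=> lAs wM wrho; apply: mu_solution_exists; last first.
  by move=> b; exact: (mu_maps_below lAs wM wrho wrho).
have wMs := wf_srcs wrho wM; have wMt := wf_tgts wrho wM.
move=> j F t; rewrite onth_map; case jA: (onth As j) => [A|] //= [<-] vt.
have wA := wf_Mu_onth wM jA.
have [vals mono] := interp_vrel wA (wf_env_scons wMs wMt vt wrho).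
split=> // b v v' /vals[]; rewrite srcs_scons tgts_scons.
rewrite -(tsubst1_tup _ (srcs rho)) -(tsubst1_tup _ (tgts rho)) => tv tv'.
by split; [apply: ty_in tv|apply: ty_in tv'] => //; rewrite onth_map jA.
Qed.

Lemma interp_local A : is_local A.
Proof.
(* One inclusion suffices by symmetry of agreement. It is proved for all environments, because the
   argument of [Arr] uses it in the opposite direction. *)
suff h : forall n rho rho' b, wf_ty n A -> wf_env n rho -> wf_env n rho' ->
    env_agree b rho rho' -> forall c v v', c <= b ->
    interp A rho c v v' -> interp A rho' c v v'.
  move=> n rho rho' b wA wrho wrho' ag c v v' cb.
  split; first exact: (h _ _ _ _ wA wrho wrho' ag _ _ _ cb).
  exact: (h _ _ _ _ wA wrho' wrho (env_agree_sym ag) _ _ _ cb).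
elim/ty_nested_ind: A => [i||A B IHA IHB|A B IHA IHB|As IH|A IH].
- by move=> n rho rho' b _ _ _ ag c v v' cb /=; have [_ _ ->] := ag i.
- by [].
- move=> n rho rho' b /= /andP[wA wB] wrho wrho' ag c v v' cb.
  move=> [v1 [v2 [v1' [v2' [-> -> h1 h2]]]]]; exists v1, v2, v1', v2'.
  by split=> //; [exact: (IHA _ _ _ _ wA wrho wrho' ag _ _ _ cb)
                |exact: (IHB _ _ _ _ wB wrho wrho' ag _ _ _ cb)].
- move=> n rho rho' b wM wrho wrho' ag c v v' cb.
  rewrite !interp_arr (env_agree_srcs ag) (env_agree_tgts ag).
  move: wM => /= /andP[wA wB].
  move=> [e [e' [-> -> tv tv' h]]]; exists e, e'; split=> // a w w' ac.
  have ab := le_trans ac cb.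
  move=> /(IHA _ _ _ _ wA wrho' wrho (env_agree_sym ag) _ _ _ ab)/(h _ _ _ ac).
  apply: bitop_agree => d x x' da; have db := le_trans da ab.
  split; first exact: (IHB _ _ _ _ wB wrho wrho' ag _ _ _ db).
  exact: (IHB _ _ _ _ wB wrho' wrho (env_agree_sym ag) _ _ _ db).
- have {}IH : all_prop is_local As.
    apply: all_prop_impl IH => A h n rho rho' b wA wrho wrho' ag c v v' cb.
    split; first exact: (h _ _ _ _ wA wrho wrho' ag _ _ _ cb).
    exact: (h _ _ _ _ wA wrho' wrho (env_agree_sym ag) _ _ _ cb).
  move=> n rho rho' b wM wrho wrho' ag c v v' cb [t sol tc].
  (* The witness [t] solves the equation for [rho] only. A solution for [rho'] exists by locality of
     the summands and agrees with [t] up to [b]. *)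
  have [s sol'] := mu_maps_solution IH wM wrho'.
  exists s => //; move: sol' (mu_maps_below IH wM wrho' wrho (env_agree_sym ag)).
  rewrite -(env_agree_srcs ag) -(env_agree_tgts ag) => sol' below'.
  have below := mu_maps_below IH wM wrho wrho' ag.
  by move: tc; apply: (mu_solution_agree below below' sol sol' _ _ cb).1.
- move=> n rho rho' b wM wrho wrho' ag c v v' cb.
  rewrite !interp_all (env_agree_srcs ag) (env_agree_tgts ag).
  move=> [e [e' [-> -> tv tv' h]]]; exists e, e'; split=> // C C' s wC wC' vs.
  have := h _ _ _ wC wC' vs; rewrite !srcs_scons !tgts_scons.
  rewrite (env_agree_srcs ag) (env_agree_tgts ag); apply: bitop_agree.
  have ws := wf_env_scons wC wC' vs.
  have ags : env_agree b (scons (Entry C C' s) rho) (scons (Entry C C' s) rho').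
    exact: env_agree_scons.
  move=> a x x' ac; have ab := le_trans ac cb.
  split; first exact: (IH _ _ _ _ wM (ws _ _ wrho) (ws _ _ wrho') ags _ _ _ ab).
  exact: (IH _ _ _ _ wM (ws _ _ wrho') (ws _ _ wrho) (env_agree_sym ags) _ _ _ ab).
Qed.

(** [interp] takes the union of all solutions. One exists and any two agree, so the union is itself
    the solution. *)
Lemma interp_mu_solution n As rho : wf_ty n (Mu As) -> wf_env n rho ->
  mu_solution (tsubst (srcs rho) (Mu As)) (tsubst (tgts rho) (Mu As))
    (mu_maps As rho) (interp (Mu As) rho).
Proof.
move=> wM wrho.
have lAs : all_prop is_local As.
  by elim: (As) => //= A s IH; split=> //; exact: interp_local.
have [t sol] := mu_maps_solution lAs wM wrho.
suff -> : interp (Mu As) rho = t by [].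
apply: funext => b; apply: funext => v; apply: funext => v'; apply: propext.
split=> [[s sol' sv]|tv]; last by exists t.
have refl_agree : env_agree b rho rho by [].
have below := mu_maps_below lAs wM wrho wrho refl_agree.
by apply/(mu_solution_agree below below sol sol' _ _ (le_refl b)).
Qed.

End Interp.

(** * The fundamental property *)

Lemma step_fst_inv l v w e : step l (Fst (Pair v w)) e -> e = Ret v.
Proof. by move=> s; inversion s. Qed.

Lemma step_snd_inv l v w e : step l (Snd (Pair v w)) e -> e = Ret w.
Proof. by move=> s; inversion s. Qed.

Lemma step_beta_inv l e v e2 : step l (App (Lam e) (Ret v)) e2 -> e2 = esubst1 v e.
Proof.
by move=> s; inversion s as [| | | | | |? ? ? ? s']; subst => //; case/step_ret: s'.
Qed.

Lemma step_tbeta_inv l e A e2 : step l (TApp (TLam e) A) e2 -> e2 = etsubst1 A e.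
Proof. by move=> s; inversion s. Qed.

Lemma step_choose_inv l e2 : step l Choose e2 -> exists k, e2 = Ret (num k).
Proof. by move=> s; inversion s; exists n. Qed.

Lemma step_case_inv l j v es e e2 : onth es j = Some e ->
  step l (Case (In j v) es) e2 -> e2 = esubst1 v e.
Proof. by move=> je s; inversion s; congruence. Qed.

Lemma cval_Mu_inv As v : cval (Mu As) v -> exists j w A,
  [/\ v = In j w, onth As j = Some A & cval (tsubst1 (Mu As) A) w].
Proof.
move=> t; inversion t as [? ? ? ? H| | | |? ? j w ? A|]; subst.
  by rewrite onth0n in H.
by exists j, w, A.
Qed.

Section Fundamental.
Context {disp : Order.disp_t} {W : orderType disp}.
Notation family := (Defs.family (W := W)).
Notation rel_env := (rel_env (W := W)).
Implicit Types (b c : W) (r s t : family) (rho : rel_env).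

Lemma top_mono A A' r b c E E' :
  c <= b -> top_rel A A' r b E E' -> top_rel A A' r c E E'.
Proof.
move=> cb [tE tE' h]; split=> // a v v' ac; apply: h; exact: le_trans cb.
Qed.

Lemma bitop_ret A A' r b v v' :
  vrel A A' r -> r b v v' -> bitop_rel A A' r b (Ret v) (Ret v').
Proof.
move=> [vals mono] rv; have [tv tv'] := vals _ _ _ rv.
split; [exact: ty_ret|exact: ty_ret|] => c E E' cb [_ _ top].
by apply: top => //; exact: mono rv.
Qed.

(** The left step keeps the index, and on the right [e1'] is the only possible reduct, so its
    termination gives that of [e']. *)
Lemma bitop_false A A' r b e1 e1' e e' : cexp A e -> cexp A' e' ->
  step false e e1 -> (forall v, e' <> Ret v) ->
  (forall l e2, step l e' e2 -> e2 = e1') ->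
  bitop_rel A A' r b e1 e1' -> bitop_rel A A' r b e e'.
Proof.
move=> te te' s eN det [_ _ h]; split=> // c E E' cb top.
move=> /(conv_false (step_fill E s))/(h _ _ _ cb top) m.
by apply: must_fill => // l e2 /det->.
Qed.

(** The function frames are moved into the evaluation contexts: related functions turn contexts
    related at the result type into contexts related at the argument type. *)
Lemma bitop_app M M' A A' B B' r s b v v' e e' :
  arr_rel M M' B B' r s b v v' -> cval (Arr A B) v -> cval (Arr A' B') v' ->
  bitop_rel A A' r b e e' -> bitop_rel B B' s b (App v e) (App v' e').
Proof.
move=> [f [f' [-> -> _ _ hf]]] tv tv' [te te' he].
split; [exact: ty_app te|exact: ty_app te'|] => c E E' cb top.
rewrite -[App (Lam f) e]/(fill (AppR (Lam f) Hole) e).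
rewrite -[App (Lam f') e']/(fill (AppR (Lam f') Hole) e') -!fill_ecat.
apply: he => //; case: (top) => sE sE' _; split.
- by move=> e0 t0; rewrite fill_ecat; apply: sE; exact: ty_app t0.
- by move=> e0 t0; rewrite fill_ecat; apply: sE'; exact: ty_app t0.
move=> a w w' ac rw; rewrite !fill_ecat /= => cv.
have [_ _ h] := hf _ _ _ (le_trans ac cb) rw.
apply: must_fill => // l e2 /step_beta_inv->.
apply: h (le_refl a) (top_mono ac top) _.
by apply: conv_false cv; apply: step_fill; exact: step_beta.
Qed.

Lemma interp_ctx_mono n G rho b c g g' : is_omega1 W -> wf_ctx n G ->
  wf_env n rho -> c <= b -> interp_ctx G rho b g g' -> interp_ctx G rho c g g'.
Proof.
move=> oW /all_onth wG wrho cb h x A xA.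
exact: (interp_vrel oW (wG _ _ xA) wrho).2 cb (h _ _ xA).
Qed.

Lemma interp_ctx_scons G rho b g g' A w w' : interp A rho b w w' ->
  interp_ctx G rho b g g' -> interp_ctx (A :: G) rho b (scons w g) (scons w' g').
Proof. by move=> hw hg [|x] B /= => [[<-]|/hg]. Qed.

Hypothesis omega1_W : is_omega1 W.

(** The clause of [Mu] relates the injections at the successor of [b], and monotonicity brings this
    down to [b]. *)
Lemma interp_In n As j A rho b v v' : wf_ty n (Mu As) -> wf_env n rho ->
  onth As j = Some A -> interp (tsubst1 (Mu As) A) rho b v v' ->
  interp (Mu As) rho b (In j v) (In j v').
Proof.
move=> wM wrho jA; rewrite interp_tsubst1 => h.
have [u hS] := interp_mu_solution omega1_W wM wrho.
have [_ mono] := uniform_vrel omega1_W u.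
have [c bc] := omega1_succ omega1_W b.
apply: (mono _ c); first by apply: ltW; case: bc.
apply/(hS _ _ bc); exists j; do 3!eexists; split; first by rewrite onth_map jA.
- by [].
- by [].
- exact: h.
Qed.

(** Opening an injection loses index: the clause is applied at the successor of [c], which is at
    most [b]. *)
Lemma interp_Mu_inv n As rho b c v v' : wf_ty n (Mu As) -> wf_env n rho ->
  c < b -> interp (Mu As) rho b v v' -> exists j A w w',
    [/\ onth As j = Some A, v = In j w, v' = In j w' &
        interp (tsubst1 (Mu As) A) rho c w w'].
Proof.
move=> wM wrho cb.
have [u hS] := interp_mu_solution omega1_W wM wrho.
have [_ mono] := uniform_vrel omega1_W u.
have [d cd] := omega1_succ omega1_W c.
move=> /(mono d b _ _ (cd.2 _ cb))/(hS _ _ cd)[j [F [w [w' []]]]].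
rewrite onth_map; case jA: (onth As j) => [A|] //= [<-] -> -> h.
by exists j, A, w, w'; rewrite interp_tsubst1.
Qed.

Lemma interp_num n rho b k : wf_env n rho -> interp natT rho b (num k) (num k).
Proof.
move=> wrho; elim: k => [|k IH].
  by apply: (@interp_In n _ _ One).
by apply: (@interp_In n _ _ (TVar 0)).
Qed.

Lemma interp_ctx_subst_ok n G rho b g g' : wf_ctx n G -> wf_env n rho ->
  interp_ctx G rho b g g' ->
  subst_ok n G 0 [::] (srcs rho) g /\ subst_ok n G 0 [::] (tgts rho) g'.
Proof.
move=> /all_onth wG wrho h; split; split=> [i /wrho[] //|x A xA].
  by have [/(_ _ _ _ (h _ _ xA))[]] := interp_vrel omega1_W (wG _ _ xA) wrho.
by have [/(_ _ _ _ (h _ _ xA))[]] := interp_vrel omega1_W (wG _ _ xA) wrho.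
Qed.

(** Mutual induction on typing derivations. Contractions keep the index except in [Case], where the
    index lost by opening a recursive value is matched by the drop that the unfold-fold step
    causes. *)
Lemma fundamental :
  (forall n G v A, val_ty n G v A -> wf_ctx n G -> forall rho b g g',
     wf_env n rho -> interp_ctx G rho b g g' ->
     interp A rho b (vsubst (srcs rho) g v) (vsubst (tgts rho) g' v)) /\
  (forall n G e A, exp_ty n G e A -> wf_ctx n G -> forall rho b g g',
     wf_env n rho -> interp_ctx G rho b g g' ->
     bitop_rel (tsubst (srcs rho) A) (tsubst (tgts rho) A) (interp A rho) b
       (esubst (srcs rho) g e) (esubst (tgts rho) g' e)).
Proof.
apply: typing_ind.
- by move=> n G x A xA _ rho b g g' _; apply.
- by [].
- move=> n G v w A B _ IHv _ IHw wG rho b g g' wrho hg /=.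
  do 4!eexists; split; [by []|by []|exact: IHv|exact: IHw].
- move=> n G e A B wA te IH wG rho b g g' wrho hg.
  have [s s'] := interp_ctx_subst_ok wG wrho hg.
  have T := ty_lam wA te.
  do 2!eexists; split; [by []|by []| | |].
  + exact: typing_subst.1 T _ _ _ _ s.
  + exact: typing_subst.1 T _ _ _ _ s'.
  move=> c w w' cb hw; rewrite !esubst1_vup; apply: IH => //.
    by rewrite /= wA.
  apply: interp_ctx_scons => //.
  exact: (interp_ctx_mono omega1_W wG wrho cb hg).
- move=> n G j v As A wM jA tv IH wG rho b g g' wrho hg.
  exact: (interp_In wM wrho jA (IH wG _ _ _ _ wrho hg)).
- move=> n G e A te IH wG rho b g g' wrho hg.
  have [s s'] := interp_ctx_subst_ok wG wrho hg.
  have T := ty_tlam te.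
  do 2!eexists; split; [by []|by []| | |].
  + exact: typing_subst.1 T _ _ _ _ s.
  + exact: typing_subst.1 T _ _ _ _ s'.
  move=> C C' r wC wC' vr; rewrite !etsubst1_tup /=.
  have -> : scons C (srcs rho) = srcs (scons (Entry C C' r) rho).
    by rewrite srcs_scons.
  have -> : scons C' (tgts rho) = tgts (scons (Entry C C' r) rho).
    by rewrite tgts_scons.
  apply: IH; [exact: wf_ctx_shift|exact: wf_env_scons|].
  (* Types in the shifted context skip the new entry of the environment, so the substitutions remain
     related. *)
  move=> x B; rewrite onth_map; case xB: (onth G x) => [B'|] //= [<-].
  by rewrite interp_tren; exact: hg.
- move=> n G v A tv IH wG rho b g g' wrho hg /=; apply: bitop_ret; last exact: IH.
  by apply: interp_vrel wrho => //; exact: typing_wf.1 tv wG.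
- move=> n G wG rho b g g' wrho hg /=; split; [exact: ty_choose|exact: ty_choose|].
  (* The right side may choose any [k]. The left can choose the same one at index [c], and numerals
     are related to themselves. *)
  move=> c E E' cb [sE sE' top] cv; apply: must_fill => // l e2 /step_choose_inv[k ->].
  apply: (top _ (num k)) (le_refl c) (interp_num _ _ wrho) _.
  by apply: conv_false cv; apply: step_fill; exact: step_choose.
- move=> n G v A B tv IH wG rho b g g' wrho hg.
  have [s s'] := interp_ctx_subst_ok wG wrho hg.
  have T := ty_fst tv.
  have /= := typing_subst.2 _ _ _ _ T _ _ _ _ s.
  have /= := typing_subst.2 _ _ _ _ T _ _ _ _ s'.
  have /andP[wA wB] := typing_wf.1 _ _ _ _ tv wG.
  have [v1 [v2 [v1' [v2' [-> -> h1 h2]]]]] := IH wG _ _ _ _ wrho hg => t' t.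
  apply: bitop_false t t' _ _ (fun _ _ => @step_fst_inv _ _ _ _) _ => //.
    exact: step_fst.
  by apply: bitop_ret h1; exact: interp_vrel wrho.
- move=> n G v A B tv IH wG rho b g g' wrho hg.
  have [s s'] := interp_ctx_subst_ok wG wrho hg.
  have T := ty_snd tv.
  have /= := typing_subst.2 _ _ _ _ T _ _ _ _ s.
  have /= := typing_subst.2 _ _ _ _ T _ _ _ _ s'.
  have /andP[wA wB] := typing_wf.1 _ _ _ _ tv wG.
  have [v1 [v2 [v1' [v2' [-> -> h1 h2]]]]] := IH wG _ _ _ _ wrho hg => t' t.
  apply: bitop_false t t' _ _ (fun _ _ => @step_snd_inv _ _ _ _) _ => //.
    exact: step_snd.
  by apply: bitop_ret h2; exact: interp_vrel wrho.
- move=> n G v e A B tv IHv te IHe wG rho b g g' wrho hg.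
  have [s s'] := interp_ctx_subst_ok wG wrho hg.
  apply: bitop_app (IHv wG _ _ _ _ wrho hg) _ _ (IHe wG _ _ _ _ wrho hg).
  + exact: typing_subst.1 tv _ _ _ _ s.
  + exact: typing_subst.1 tv _ _ _ _ s'.
- move=> n G v es As B tv IHv sz wB tes IHes wG rho b g g' wrho hg.
  have [s s'] := interp_ctx_subst_ok wG wrho hg.
  have T := ty_case tv sz wB tes.
  have wM := typing_wf.1 _ _ _ _ tv wG.
  split; [exact: typing_subst.2 T _ _ _ _ s|exact: typing_subst.2 T _ _ _ _ s'|].
  move=> c E E' cb top /=.
  (* That the left value is an injection comes from its typing: at index zero the relation says
     nothing, and a smaller index is available only after the left has stepped. *)
  have := typing_subst.1 _ _ _ _ tv _ _ _ _ s.
  move=> /cval_Mu_inv[j [w [A [vE jA _]]]].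
  have [e je] : exists e, onth es j = Some e.
    have : (j < size es)%N.
      by rewrite sz -(size_map (tsubst (tup (srcs rho)))) -onthTE jA.
    by rewrite -onthTE; case: (onth es j) => // e _; exists e.
  have := (interp_vrel omega1_W wM wrho).2 _ _ _ _ cb (IHv wG _ _ _ _ wrho hg).
  rewrite vE => hv.
  have st : step true (Case (In j w) (map (esubst (srcs rho) (vup g)) es))
      (esubst (srcs rho) (scons w g) e).
    by rewrite -esubst1_vup; apply: step_case; rewrite onth_map je.
  (* The left reduct converges at some [a < c], and at [a] the relation can be opened to give
     related payloads. *)
  move=> /(conv_true (step_fill E st))[a ac cv].
  have [i [D [x [x' [iD [? ?] v'E hx]]]]] := interp_Mu_inv wM wrho ac hv.
  subst i x; rewrite v'E; apply: must_fill => // l e2.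
  move=> /step_case_inv-/(_ (esubst (tgts rho) (vup g') e)).
  rewrite onth_map je => /(_ erefl)->; rewrite esubst1_vup.
  have wD := wf_unfold wM iD.
  have [||_ _ h] := IHes _ _ _ je iD _ rho a (scons w g) (scons x' g') wrho.
  + by rewrite /= wD.
  + apply: interp_ctx_scons => //.
    exact: (interp_ctx_mono omega1_W wG wrho (le_trans (ltW ac) cb) hg).
  exact: h (le_refl a) (top_mono (ltW ac) top) cv.
- move=> n G v A B tv IH wB wG rho b g g' wrho hg.
  have [s s'] := interp_ctx_subst_ok wG wrho hg.
  have T := ty_tapp tv wB.
  have /= := typing_subst.2 _ _ _ _ T _ _ _ _ s.
  have /= := typing_subst.2 _ _ _ _ T _ _ _ _ s'.
  have [e [e' [-> -> _ _ h]]] := IH wG _ _ _ _ wrho hg => t' t.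
  apply: bitop_false t t' _ _ (fun _ _ => @step_tbeta_inv _ _ _ _) _ => //.
    exact: step_tbeta.
  rewrite interp_tsubst1 srcs_tsubst1 tgts_tsubst1.
  (* The quantified relation is instantiated by the interpretation of [B]. *)
  have := h _ _ _ (wf_srcs wrho wB) (wf_tgts wrho wB) (interp_vrel omega1_W wB wrho).
  by cbv zeta; rewrite srcs_scons tgts_scons.
Qed.

End Fundamental.

(** * A closed term with exactly one type *)

Lemma app_inv n G v e B : exp_ty n G (App v e) B ->
  exists2 A, val_ty n G v (Arr A B) & exp_ty n G e A.
Proof. by move=> t; inversion t; exists A. Qed.

Lemma let_inv n G f e B : exp_ty n G (App (Lam f) e) B ->
  exists2 A, exp_ty n (A :: G) f B & exp_ty n G e A.
Proof. by move=> /app_inv[A t]; inversion t; exists A. Qed.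

Lemma var_inv n G x A : val_ty n G (Var x) A -> onth G x = Some A.
Proof. by move=> t; inversion t. Qed.

Lemma fst_inv n G v B : exp_ty n G (Fst v) B -> exists C, val_ty n G v (Prod B C).
Proof. by move=> t; inversion t; exists B0. Qed.

Lemma case_inv n G v es B : exp_ty n G (Case v es) B ->
  exists As, val_ty n G v (Mu As).
Proof. by move=> t; inversion t; exists As. Qed.

Lemma tapp_inv n G v A B : exp_ty n G (TApp v A) B ->
  exists2 C, val_ty n G v (All C) & B = tsubst1 A C.
Proof. by move=> t; inversion t; exists A0. Qed.

(* Binds [x] to a value of type [forall a. a] and returns [x[A]]. Since [x] is
   monomorphic, projecting from [x[1 * 1]] and analysing [x[mu a. (empty sum)]]
   leaves [forall a. a] as its only possible type. *)
Definition probe (A : ty) : exp :=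
  App (Lam (App (Lam (App (Lam (TApp (Var 2) A))
                        (App (Lam (Case (Var 0) [::])) (TApp (Var 1) (Mu [::])))))
              (App (Lam (Fst (Var 0))) (TApp (Var 0) (Prod One One)))))
    (Ret (TLam omega)).

(** Makes [TLam omega] an inhabitant of [All (TVar 0)]. Under the [Mu] of its recursive type the
    outer variable becomes [TVar 1]. *)
Lemma omega_ty_var n G : exp_ty n.+1 G omega (TVar 0).
Proof.
have delta_ty : val_ty n.+1 G delta (Arr (Mu [:: Arr (TVar 0) (TVar 1)]) (TVar 0)).
  apply: ty_lam => //; apply: (ty_case (As := [:: Arr (TVar 0) (TVar 1)])) => //.
    exact: ty_var.
  case=> [|[|j]] e A //= [<-] [<-]; rewrite /tsubst1 /=.
  by apply: ty_app; last apply: ty_ret; apply: ty_var; reflexivity.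
apply: ty_app; first exact: delta_ty.
by apply: ty_ret; apply: ty_in => //=; exact: delta_ty.
Qed.

Lemma ty_tapp_var n G x A :
  onth G x = Some (All (TVar 0)) -> wf_ty n A -> exp_ty n G (TApp (Var x) A) A.
Proof. by move=> xG wA; have := ty_tapp (ty_var n xG) wA. Qed.

Lemma probe_ty A : closed_ty A -> cexp A (probe A).
Proof.
move=> wA; apply: (@ty_app _ _ _ _ (All (TVar 0))); last first.
  by apply: ty_ret; apply: ty_tlam; exact: omega_ty_var.
apply: ty_lam => //; apply: (@ty_app _ _ _ _ One); last first.
  apply: (@ty_app _ _ _ _ (Prod One One)).
    by apply: ty_lam => //; apply: ty_fst; exact: ty_var.
  exact: ty_tapp_var.
apply: ty_lam => //; apply: (@ty_app _ _ _ _ One); last first.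
  apply: (@ty_app _ _ _ _ (Mu [::])).
    apply: ty_lam => //; apply: (@ty_case _ _ _ _ [::]) => //.
      exact: ty_var.
    by move=> j e B; rewrite onth0n.
  exact: ty_tapp_var.
by apply: ty_lam => //; exact: ty_tapp_var.
Qed.

Lemma probe_ty_unique A B : cexp B (probe A) -> B = A.
Proof.
move=> /let_inv[X /let_inv[Y /let_inv[Z t1 t2] t3] _].
have [C /var_inv[XE] ->] := tapp_inv t1.
have [P' /fst_inv[Q' /var_inv[PE]] /tapp_inv[C1 /var_inv[C1E] E1]] := let_inv t3.
have [M' /case_inv[As /var_inv[ME]] /tapp_inv[C2 /var_inv[C2E] E2]] := let_inv t2.
move: E1 E2; rewrite PE ME; move: C1E C2E; rewrite XE => -[<-] [<-] E1 E2.
(* Any body [C] other than [TVar 0] has a head fixed under instantiation, which cannot be both a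
   product and a recursive sum. *)
by case: C {XE} E1 E2 => [[|i]||? ?|? ?|?|?].
Qed.

(** * The logical relation is the CIU preorder *)

Section LogCiu.
Context {disp : Order.disp_t} {W : orderType disp}.
Notation rel_env := (rel_env (W := W)).
Hypothesis omega1_W : is_omega1 W.

(* Its type substitutions are the identity, and no type variable is in scope. *)
Definition empty_env : rel_env := fun i => Entry (TVar i) (TVar i) (fun _ _ _ => False).

Lemma wf_empty_env : wf_env 0 empty_env.
Proof. by []. Qed.

Lemma interp_closed A b v : cval A v -> interp A empty_env b v v.
Proof.
move=> tv; have ctx : interp_ctx [::] empty_env b Var Var by move=> x B; rewrite onth0n.
have := (fundamental omega1_W).1 _ _ _ _ tv isT _ _ _ _ wf_empty_env ctx.
by rewrite subst_id.1.
Qed.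

(** Peeling off frames, the typing of the filled probe types each function value, and closed values
    are self-related. At the hole the unique type of the probe forces [B] to be [A]. *)
Lemma bitop_fill A B E b e e' : cexp B (fill E (probe A)) ->
  bitop_rel A A (interp A empty_env) b e e' ->
  bitop_rel B B (interp B empty_env) b (fill E e) (fill E e').
Proof.
elim: E B => [|v E IH] B /=; first by move=> /probe_ty_unique->.
move=> /app_inv[C tv tE] h.
have := interp_closed b tv; rewrite interp_arr.
rewrite -[srcs empty_env]/TVar -[tgts empty_env]/TVar !tsubst_id.
by move=> hv; apply: (bitop_app hv tv tv); exact: IH.
Qed.

Lemma log_ciu n G A e e' : log (W := W) n G e e' A -> ciu n G e e' A.
Proof.
move=> [_ _ h] d g E hd hg hE m.
have [b cv] := must_conv omega1_W m.
pose rho := env_subst d empty_env.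
have rhoE : srcs rho = d by apply: funext => i; exact: tsubst_id.
have wrho : wf_env n rho.
  move=> i /hd wi; have := interp_vrel omega1_W wi wf_empty_env.
  by rewrite /rho /= -[srcs _]/TVar -[tgts _]/TVar !tsubst_id.
have hctx : interp_ctx G rho b g g.
  move=> x B xB; rewrite -interp_tsubst; apply: interp_closed; apply: hg.
  by rewrite onth_map xB.
have := h _ _ _ _ wrho hctx; rewrite -interp_tsubst -[tgts rho]/(srcs rho) rhoE.
move=> hb; have [te _ _] := hb.
have wA : closed_ty (tsubst d A) by exact: typing_wf.2 te isT.
(* The stack condition is used at the probe, whose typing determines the types of the frames of
   [E]. *)
have [B tB] := hE _ (probe_ty wA).
have [_ _ hB] := bitop_fill tB hb.
(* With [E] absorbed into the terms the empty contexts suffice; they are related because returned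
   values do not reduce. *)
apply: (hB b Hole Hole (le_refl b) _ cv).
split=> [e0 t0|e0 t0|c v v' _ _ _]; [by exists B|by exists B|].
exact: must_ret.
Qed.

Lemma ciu_log n G A e e' : wf_ctx n G -> exp_ty n G e A -> exp_ty n G e' A ->
  ciu n G e e' A -> log (W := W) n G e e' A.
Proof.
move=> wG te te' h; split=> // rho b g g' wrho hg.
have [s s'] := interp_ctx_subst_ok omega1_W wG wrho hg.
have [te0 _ he] := (fundamental omega1_W).2 _ _ _ _ te wG _ _ _ _ wrho hg.
split=> //; first exact: typing_subst.2 te' _ _ _ _ s'.
(* Self-relatedness of [e] transfers convergence to [E'] and [g']; there the CIU hypothesis replaces
   [e] by [e']. *)
move=> c E E' cb top cv; have [_ sE' _] := top.
apply: h sE' (he _ _ _ cb top cv); first by move=> i /wrho[].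
move=> x B; rewrite onth_map; case xB: (onth G x) => [B'|] //= [<-].
exact: s'.2.
Qed.

End LogCiu.

Theorem theorem5p5 (disp : Order.disp_t) (W : orderType disp)
    (omega1_W : is_omega1 W) (n : nat) (G : seq ty) (A : ty) (e e' : exp)
    (wf_G : wf_ctx n G) (e_A : exp_ty n G e A) (e'_A : exp_ty n G e' A) :
  log (W := W) n G e e' A <-> ciu n G e e' A.
Proof. by split; [exact: log_ciu|exact: ciu_log]. Qed.
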